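(* For any $k\le \frac n2$, any $T\in\mathbf{Tab}_{(n-k,k)}$ and any $\sigma'\in D(\sigma_T)$, the set $A(\sigma')$ contains exactly two elements, namely $A(\sigma')=\{\sigma_T,\sigma_S\}$ for some $S\in\mathbf{Tab}_{(n-k,k)}$, and $$\overline{\mathcal B}_{T}\cap\overline{\mathcal B}_{S}\cap\mathcal O_{(n-k,k)}=\overline{\mathcal B}_{\sigma'}\cap\mathcal O_{(n-k,k)},$$ so that this intersection is irreducible.
   Context: Work over $\mathbb C$. $\mathbf B\subset GL_n$ is the group of invertible upper-triangular $n\times n$ matrices, acting by conjugation on the space $\mathfrak n$ of strictly upper-triangular $n\times n$ matrices. $\mathcal O_{(n-k,k)}$ is the $GL_n$-conjugacy class of $n\times n$ matrices $x$ with $x^2=0$ and rank $k$. $\mathbf{Tab}_{(n-k,k)}$ is the set of Young tableaux with entries $1,\dots,n$ (each used once, increasing along rows and down columns) with two columns, the first of length $n-k$ and the second of length $k$. For such $T$, let $\langle T_1\rangle$ and $\langle T_2\rangle$ be the sets of entries of its first and second column, and write $\langle T_2\rangle=\{j_1<\dots<j_k\}$. Define $\sigma_T=(i_1,j_1)\cdots(i_k,j_k)$, where $i_1=j_1-1$ and, for $s>1$, $i_s=\max\{d\in\langle T_1\rangle\setminus\{i_1,\dots,i_{s-1}\}: d<j_s\}$. $\mathbf S_n^2=\{\sigma\in \mathbf S_n:\sigma^2=\mathrm{Id}\}$, and $\mathbf S_n^2(k)$ is the subset of products of exactly $k$ disjoint 2-cycles. For $\sigma\in\mathbf S_n^2$,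 $N_\sigma\in\mathfrak n$ is the matrix with $(N_\sigma)_{i,j}=1$ if $i<j$ and $\sigma(i)=j$, and $0$ otherwise; $\mathcal B_\sigma=\{bN_\sigma b^{-1}: b\in\mathbf B\}$; bars denote Zariski closure; $\mathcal B_T:=\mathcal B_{\sigma_T}$. Rank matrix: $R_\sigma$ is the $n\times n$ matrix with $(R_\sigma)_{i,j}=0$ for $i\ge j$ and, for $i<j$, $(R_\sigma)_{i,j}$ equal to the rank of the submatrix of $N_\sigma$ with rows and columns $i,\dots,j$. Partial order: $\sigma'\preceq\sigma$ if $(R_{\sigma'})_{i,j}\le (R_\sigma)_{i,j}$ for all $i,j$; $\prec$ is the strict version. (It is known that $\sigma'\preceq\sigma$ iff $\mathcal B_{\sigma'}\subseteq\overline{\mathcal B}_\sigma$.) For $\sigma\in\mathbf S_n^2(k)$: $D(\sigma)$ (descendants) is the set of $\sigma'\in\mathbf S_n^2(k)$ with $\sigma'\prec\sigma$ and no $\sigma''$ with $\sigma'\prec\sigma''\prec\sigma$; $A(\sigma)$ (ancestors) is the set of $\sigma'\in\mathbf S_n^2(k)$ with $\sigma'\succ\sigma$ and no $\sigma''$ with $\sigma'\succ\sigma''\succ\sigma$. *)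

(* Defs.v *)
From HB Require Import structures.
From mathcomp Require Import all_boot all_order all_algebra all_fingroup.
From mathcomp Require Import complex.
From mathcomp Require Import boolp classical_sets.
From mathcomp Require Import reals.
From mathcomp Require mpoly.

Set Implicit Arguments.
Unset Strict Implicit.
Unset Printing Implicit Defensive.

(* Indices and tableau entries 1, ..., n are represented by 'I_n = {0, ..., n-1};
   every entry is thus shifted down by one. *)

(* Columns are listed from top to bottom.  The default 0 of nth is never
   reached when 2 * k <= n. *)
Record tableau (n k : nat) := Tableau {
  col1 : (n - k).-tuple 'I_n;
  col2 : k.-tuple 'I_n;
  tableau_entries : perm_eq (col1 ++ col2) (enum 'I_n);
  tableau_col1 : sorted ltn [seq val d | d <- col1];
  tableau_col2 : sorted ltn [seq val d | d <- col2];
  tableau_rows : forall s, s < k ->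
    nth 0 [seq val d | d <- col1] s < nth 0 [seq val d | d <- col2] s
}.

(* The pairs (i_s, j_s) for the remaining entries j_s, the list used holding
   i_1, ..., i_(s-1).  The case used = [::] is s = 1, where ord_pred j is j - 1
   since j > 0 for a tableau.  The bound j of arg max is only a default value,
   returned when no d satisfies the condition. *)
Fixpoint tableau_pairs (n : nat) (c1 used js : seq 'I_n) : seq ('I_n * 'I_n) :=
  if js is j :: js' then
    let i := if used is [::] then ord_pred j else
      [arg max_(d > j | [&& d \in c1, d \notin used & d < j]) (d : nat)] in
    (i, j) :: tableau_pairs c1 (i :: used) js'
  else [::].

Definition tableau_perm (n k : nat) (T : tableau n k) : 'S_n :=
  (\prod_(p <- tableau_pairs (col1 T) [::] (col2 T)) tperm p.1 p.2)%g.

Definition involutions (n : nat) : {set 'S_n} := [set s : 'S_n | s * s == 1]%g.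

Definition involutions_rank (n k : nat) : {set 'S_n} :=
  [set s in involutions n | #|[set c in porbits s | #|c| == 2]| == k].

Section Matrices.

Local Open Scope ring_scope.

Variables (F : fieldType) (n : nat).

Definition inv_mx (s : 'S_n) : 'M[F]_n :=
  \matrix_(i, j) ((i < j)%N && (s i == j))%:R.

Definition interval_submx (i j : 'I_n) (A : 'M[F]_n) :
    'M[F]_(#|[set m : 'I_n | (i <= m <= j)%N]|) :=
  mxsub (fun a => enum_val a) (fun b => enum_val b) A.

Definition rank_mx (s : 'S_n) (i j : 'I_n) : nat :=
  if (i < j)%N then \rank (interval_submx i j (inv_mx s)) else 0%N.

Definition inv_le (s' s : 'S_n) : bool :=
  [forall i, forall j, (rank_mx s' i j <= rank_mx s i j)%N].

Definition inv_lt (s' s : 'S_n) : bool := (s' != s) && inv_le s' s.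

Definition descendants (k : nat) (s : 'S_n) : {set 'S_n} :=
  [set s' in involutions_rank n k | inv_lt s' s &
    ~~ [exists s'' in involutions n, inv_lt s' s'' && inv_lt s'' s]].

Definition ancestors (k : nat) (s : 'S_n) : {set 'S_n} :=
  [set s' in involutions_rank n k | inv_lt s s' &
    ~~ [exists s'' in involutions n, inv_lt s s'' && inv_lt s'' s']].

Local Open Scope classical_set_scope.

(* is_trig_mx is lower triangularity. *)
Definition borel : set 'M[F]_n :=
  [set b | is_trig_mx b^T /\ b \in unitmx].

Definition borel_orbit (s : 'S_n) : set 'M[F]_n :=
  [set b *m inv_mx s *m invmx b | b in borel].

Definition square_zero_class (k : nat) : set 'M[F]_n :=
  [set x | x *m x = 0 /\ \rank x = k].

Definition mx_eval (p : mpoly.mpoly (n * n) F) (x : 'M[F]_n) : F :=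
  mpoly.meval (fun l => mxvec x 0 l) p.

Definition zariski_closed (Z : set 'M[F]_n) : Prop :=
  exists P : set (mpoly.mpoly (n * n) F),
    Z = [set x | forall p, P p -> mx_eval p x = 0].

Definition zariski_closure (X : set 'M[F]_n) : set 'M[F]_n :=
  smallest zariski_closed X.

(* Irreducibility of X for the topology induced by the Zariski topology. *)
Definition zariski_irreducible (X : set 'M[F]_n) : Prop :=
  X !=set0 /\
  forall Y Z : set 'M[F]_n, zariski_closed Y -> zariski_closed Z ->
    X `<=` Y `|` Z -> X `<=` Y \/ X `<=` Z.

End Matrices.

(* Main.v *)
Require Import Defs.
From HB Require Import structures.
From mathcomp Require Import all_boot all_order all_algebra all_fingroup.
From mathcomp Require Import zify.

(** An involution s is a pattern of arcs, the pairs a < s a, and the rank of the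
    submatrix of N_s on an interval is the number of arcs inside this interval.
    So the order compares, interval by interval, these counts (arcs, arcs_le).
    A defect is a crossing of two arcs or a fixed point below an arc. The
    involutions sigma_T are those with k arcs and no defect (tableau_permP,
    exists_tableau). They are maximal: the interval below each of their arcs is
    full, all its points being matched inside it, and a full interval stays full
    in every larger involution (no_defect_maximal).

    Exchanging adjacent points p and p + 1 behaves like a simple reflection of a
    Coxeter group. Only the intervals separating p from p + 1 change, and for
    them the larger of s and its conjugate attains the maximum that the other
    intervals permit; hence a lifting property (uncrossed_leJ, uncrossed_leJJ).
    Induction by exchanges (lifting_step) has two consequences. The first is
    that the number of defects grades the order (exists_one_more_defect), so that
    a descendant of sigma_T has exactly one defect. The second is that the order
    implies inclusion of orbit closures (arcs_le_closure), because the closure of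
    the orbit of the larger of s and its conjugate is stable under the minimal
    parabolic subgroup of p and p + 1 (closure_parabolic).

    Let u have exactly one defect. It can be removed in two ways (nested, parted).
    Away from the defect the arcs of u bound full intervals, which forces every
    involution above u to be u or one of these two (above_one_defect). Hence u has
    exactly two ancestors, both without defect; if one is sigma_T, the other is
    some sigma_S (descendant_of_no_defect).

    Both ancestors gain arcs over u, but never in the same interval, so the
    minimum of their counts is the count of u (arcs_min_resolutions). A strictly
    upper triangular matrix of square zero is conjugate under the Borel subgroup
    to some N_r (normal_form). If it lies in both closures, then r is below both
    ancestors, because rank conditions are closed, hence below u; so the matrix
    lies in the closure of the orbit of u (closure_meet). This orbit is
    irreducible, as the image of a group that is open in a vector space
    (irreducible_conj). *)

Set Implicit Arguments.
Unset Strict Implicit.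
Unset Printing Implicit Defensive.

(** * Arcs inside an interval *)

Section Arcs.

Variable n : nat.
Implicit Types (r s t u : 'S_n) (x y z a b p q : 'I_n) (i j : nat).

(** Half-open intervals [i, j): the intervals that separate the neighbours p
    and p + 1 are then exactly those with an end at p + 1. *)
Definition arcs s i j := #|[set a : 'I_n | [&& i <= a, a < s a & s a < j]]|.

Definition arcs_le s t := forall i j, arcs s i j <= arcs t i j.

Lemma arcs_row s p j :
  arcs s p j = ((p < s p) && (s p < j)) + arcs s p.+1 j.
Proof.
rewrite /arcs (cardsD1 p) inE leqnn /=; congr (_ + _).
apply: eq_card => a; rewrite !inE -val_eqE /=; lia.
Qed.

Lemma arcs_col s p i : involutive s ->
  arcs s i p.+1 = ((i <= s p) && (s p < p)) + arcs s i p.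
Proof.
move=> sK; rewrite /arcs (cardsD1 (s p)) inE sK ltnS leqnn andbT.
congr (_ + _); apply: eq_card => a; rewrite !inE.
have -> : (a != s p) = (s a != p) by rewrite -(inj_eq (@perm_inj _ s) a) sK.
rewrite -val_eqE /=; lia.
Qed.

Lemma arcs_out s i j : j <= i.+1 -> arcs s i j = 0.
Proof.
move=> ji; apply/eqP; rewrite cards_eq0; apply/eqP/setP=> a.
rewrite !inE; lia.
Qed.

(** Counting both ends of each arc removes the order of the ends, which
    conjugation does not respect. *)
Lemma arcs_double s i j : involutive s ->
  (arcs s i j).*2 =
  #|[set a | [&& s a != a, i <= a < j & i <= s a < j]]|.
Proof.
move=> sK; set A := [set a | _].
rewrite -(cardsID [set a : 'I_n | a < s a] A) -addnn; congr (_ + _).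
  apply: eq_card => a; rewrite !inE -val_eqE /=; lia.
rewrite /arcs -(card_imset _ (@perm_inj _ s)); apply: eq_card => b.
rewrite -[b]sK (mem_imset _ _ (@perm_inj _ s)) !inE !sK -val_eqE /=; lia.
Qed.

Lemma arcsJ s x y i j : involutive s ->
  (i <= x < j) = (i <= y < j) -> arcs (s ^ tperm x y) i j = arcs s i j.
Proof.
move=> sK xy; apply: double_inj; rewrite !arcs_double //; last first.
  by move=> z; rewrite -[z](tpermK x y) !permJ sK.
set t := tperm x y.
rewrite -(card_imset _ (@perm_inj _ t)); apply: eq_card => b.
have tI z : (i <= t z < j) = (i <= z < j) by rewrite /t; case: tpermP => // ->.
have tK : involutive t by exact: tpermK.
rewrite -[b]tK (mem_imset _ _ (@perm_inj _ t)) !inE !permJ !tI.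
by rewrite (inj_eq perm_inj) !tK.
Qed.

Lemma involutiveJ s x y : involutive s -> involutive (s ^ tperm x y)%g.
Proof. by move=> sK z; rewrite -[z](tpermK x y) !permJ sK. Qed.

Lemma conj_tpermK s x y : ((s ^ tperm x y) ^ tperm x y)%g = s.
Proof. by rewrite -conjgM tperm2 conjg1. Qed.

Lemma conj_tpermE s x y z : (s ^ tperm x y)%g z = tperm x y (s (tperm x y z)).
Proof. by rewrite -{1}[z](tpermK x y) permJ. Qed.

Lemma arcs_row_neq s p j :
  (p < s p) && (s p < j) = (arcs s p.+1 j != arcs s p j).
Proof. by rewrite arcs_row; case: (_ && _) => /=; lia. Qed.

Lemma arcsJ_total s x y : involutive s ->
  arcs (s ^ tperm x y)%g 0 n = arcs s 0 n.
Proof. by move=> sK; rewrite arcsJ // !ltn_ord. Qed.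

Lemma involution_eq r s : involutive r -> involutive s ->
    (forall a, a < r a -> s a = r a) -> (forall a, a < s a -> s a = r a) ->
  s = r.
Proof.
move=> rK sK hr hs; apply/permP => a.
have [|ra] := boolP (a < r a); first exact: hr.
have [|sa] := boolP (a < s a); first exact: hs.
have [ra'|ra'] := boolP (r a < a).
  by have := hr (r a); rewrite rK => /(_ ra') e; rewrite -[in LHS]e sK.
have [sa'|sa'] := boolP (s a < a).
  by have := hs (s a); rewrite sK => /(_ sa') e; rewrite [in RHS]e rK.
by apply: val_inj => /=; lia.
Qed.

Lemma arcs_le_trans r s u : arcs_le s r -> arcs_le r u -> arcs_le s u.
Proof. by move=> sr ru i j; apply: leq_trans (sr i j) (ru i j). Qed.

(** Letting j vary in arcs s a j - arcs s a.+1 j recovers whether a is a left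
    end, and then the other end of its arc. *)
Lemma arcs_le_anti s t :
  involutive s -> involutive t -> arcs_le s t -> arcs_le t s -> s = t.
Proof.
move=> sK tK st ts.
have E i j : arcs s i j = arcs t i j by apply/eqP; rewrite eqn_leq st ts.
have H a j : (a < s a) && (s a < j) = (a < t a) && (t a < j).
  by rewrite !arcs_row_neq !E.
have L a : a < s a -> s a = t a.
  move=> sa; have := H a (s a).+1; have := H a (t a).+1 => h1 h2.
  apply: val_inj => /=; lia.
apply: involution_eq => // a ta; have := H a (t a).+1 => h1; apply: L; lia.
Qed.

End Arcs.

(** * Exchanging two adjacent points *)

Section Lifting.

Variable n : nat.
Implicit Types (s t u r : 'S_n) (x y z a b : 'I_n) (i j : nat).

(** Of s and its conjugate by the exchange of p and q = p + 1, this selects the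
    one with at least as many arcs in every interval: the arcs at p and q are
    nested or lie on opposite sides, and neither p nor q is fixed below the arc
    of the other. It holds in particular when p and q are both fixed, and it excludes the arc
    joining p and q. *)
Definition uncrossed s p q :=
  [&& s p != q, (p < s p) ==> (q < s q < s p) & (s q < q) ==> (s q < s p < p)].

(** A crossing of two arcs, recorded by their left ends, or an arc over a fixed
    point, recorded by its left end and that point. *)
Definition defects s : {set 'I_n * 'I_n} :=
  [set e : 'I_n * 'I_n | [&& e.1 < e.2, e.2 < s e.1 & (s e.2 == e.2) || (s e.1 < s e.2)]].

Variables p q : 'I_n.
Hypothesis pq : q = p.+1 :> nat.

Lemma ord_eqE (x y : 'I_n) : (x == y) = (x == y :> nat).
Proof. by []. Qed.

Lemma adjacent_images s : involutive s ->
  (s p == q :> nat) = (s q == p :> nat) /\ (s p != s q :> nat).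
Proof.
move=> sK; split; last first.
  by rewrite -ord_eqE (inj_eq perm_inj) ord_eqE pq neq_ltn ltnSn.
by rewrite -!ord_eqE -(inj_eq (@perm_inj _ s)) sK eq_sym.
Qed.

Lemma arcs_adjacent s i j : involutive s ->
  [/\ arcs s i q = ((i <= s p) && (s p < p)) + arcs s i p,
      arcs s i q.+1 = ((i <= s q) && (s q < q)) + arcs s i q,
      arcs s p j = ((p < s p) && (s p < j)) + arcs s q j
    & arcs s q j = ((q < s q) && (s q < j)) + arcs s q.+1 j].
Proof.
move=> sK; split; last exact: arcs_row.
- by rewrite {1}pq arcs_col.
- exact: arcs_col.
- by rewrite pq arcs_row.
Qed.

Let pq_out i j s : involutive s -> i != q :> nat -> j != q :> nat ->
  arcs (s ^ tperm p q) i j = arcs s i j.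
Proof. by move=> sK iq jq; apply: arcsJ => //; lia. Qed.

Lemma conj_adjacent s : involutive s -> s p != q ->
  ((s ^ tperm p q)%g p = if s q == q then p else s q) /\
  ((s ^ tperm p q)%g q = if s p == p then q else s p).
Proof.
move=> sK spq; rewrite !conj_tpermE tpermL tpermR.
have sqp : s q != p by rewrite -(inj_eq (@perm_inj _ s)) sK eq_sym.
by split; case: tpermP => // [e|e|e1 e2]; rewrite ?e ?eqxx // in spq sqp *;
   case: eqP.
Qed.

(** Only the intervals with an end at q see the exchange. For these, the counts
    of the two intervals that move this end by one step leave two values at
    most: an uncrossed involution takes the larger one, its conjugate the
    smaller one. *)
Lemma uncrossed_col s i : involutive s -> uncrossed s p q ->
  arcs s i q = minn (arcs s i p).+1 (arcs s i q.+1) /\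
  arcs (s ^ tperm p q) i q = maxn (arcs s i p) (arcs s i q.+1).-1.
Proof.
move=> sK up; have [E1 E2 _ _] := arcs_adjacent i 0 sK.
have sJ := @involutiveJ _ s p q sK.
have [F1 _ _ _] := arcs_adjacent i 0 sJ.
have [a1 a2] := adjacent_images sK.
have spq : s p != q by case/and3P: up.
have [C1 _] := conj_adjacent sK spq.
have [qi|iq] := boolP (q <= i).
  have pi: p <= i by lia.
  rewrite !arcs_out //; lia.
have := pq_out (i:=i) (j:=p) sK; rewrite F1 C1 => -> //; try lia.
move: up a1 a2 E1 E2 iq; rewrite /uncrossed !ord_eqE => /and3P[].
by case: ifP; case: (ltngtP (s p) p); case: (ltngtP (s q) q);
  clear -pq; lia.
Qed.

Lemma uncrossed_row s j : involutive s -> uncrossed s p q ->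
  arcs s q j = minn (arcs s q.+1 j).+1 (arcs s p j) /\
  arcs (s ^ tperm p q) q j = maxn (arcs s q.+1 j) (arcs s p j).-1.
Proof.
move=> sK up; have [_ _ E1 E2] := arcs_adjacent 0 j sK.
have sJ := @involutiveJ _ s p q sK.
have [_ _ _ F1] := arcs_adjacent 0 j sJ.
have [a1 a2] := adjacent_images sK.
have spq : s p != q by case/and3P: up.
have [_ C1] := conj_adjacent sK spq.
have [jq|qj] := boolP (j <= q).
  rewrite !arcs_out //; lia.
have := pq_out (i:=q.+1) (j:=j) sK; rewrite F1 C1 => -> //; try lia.
move: up a1 a2 E1 E2 qj; rewrite /uncrossed !ord_eqE => /and3P[].
by case: ifP; case: (ltngtP (s p) p); case: (ltngtP (s q) q);
  clear -pq; lia.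
Qed.

Lemma arcs_bounds s i j : involutive s ->
  [/\ arcs s i q <= minn (arcs s i p).+1 (arcs s i q.+1),
      maxn (arcs s i p) (arcs s i q.+1).-1 <= arcs s i q,
      arcs s q j <= minn (arcs s q.+1 j).+1 (arcs s p j)
    & maxn (arcs s q.+1 j) (arcs s p j).-1 <= arcs s q j].
Proof. by move=> sK; have [] := arcs_adjacent i j sK; split; lia. Qed.

Let s_i s := (s ^ tperm p q)%g.

(** The lifting property of Coxeter groups, in its two forms: the count of an
    uncrossed s is a monotone function of counts that the exchange fixes. *)
Lemma uncrossed_leJ s u : involutive s -> involutive u -> uncrossed s p q ->
  arcs_le u s -> arcs_le (s_i u) s.
Proof.
move=> sK uK up us i j.
have uJ := @involutiveJ _ u p q uK.
have pq' : p != q :> nat by rewrite pq; lia.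
have qq' : q.+1 != q :> nat by lia.
have [->|iq] := eqVneq i q.
  have [_ _ b _] := arcs_bounds 0 j uJ.
  have [-> _] := uncrossed_row j sK up.
  apply: leq_trans b _; have [->|jq] := eqVneq j q; first by rewrite !arcs_out; lia.
  rewrite !pq_out //; have := us q.+1 j; have := us p j.
  by clear; lia.
have [->|jq] := eqVneq j q.
  have [b _ _ _] := arcs_bounds i 0 uJ.
  have [-> _] := uncrossed_col i sK up.
  apply: leq_trans b _; rewrite !pq_out //.
  have := us i q.+1; have := us i p.
  by clear; lia.
by rewrite /s_i pq_out.
Qed.

Lemma uncrossed_leJJ s u : involutive s -> involutive u -> uncrossed s p q ->
  uncrossed u p q -> arcs_le u s -> arcs_le (s_i u) (s_i s).
Proof.
move=> sK uK up uup us i j.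
have [->|iq] := eqVneq i q.
  have [_ e2] := uncrossed_row j sK up; have [_ f2] := uncrossed_row j uK uup.
  rewrite /s_i e2 f2; have := us q.+1 j; have := us p j.
  by clear; lia.
have [->|jq] := eqVneq j q.
  have [_ e1] := uncrossed_col i sK up; have [_ f1] := uncrossed_col i uK uup.
  rewrite /s_i e1 f1; have := us i q.+1; have := us i p.
  by clear; lia.
by rewrite /s_i !pq_out.
Qed.

Lemma uncrossed_total s : involutive s -> s p != q ->
  uncrossed s p q || uncrossed (s_i s) p q.
Proof.
move=> sK spq; have [c1 c2] := conj_adjacent sK spq.
have [a1 a2] := adjacent_images sK.
rewrite /uncrossed c1 c2 !ord_eqE.
case: ifP => e; case: ifP => e'; lia.
Qed.

Let t := tperm p q.

Lemma tperm_lt x y : (t x < t y) =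
  if (x == p) && (y == q) then false else
  if (x == q) && (y == p) then true else x < y.
Proof.
by rewrite /t; do 2?[case: tpermP => [->|->|/eqP+ /eqP+]];
  rewrite !ord_eqE; do 4?[case: ifP]; lia.
Qed.

End Lifting.

Section DefectsJ.

Variable n : nat.
Implicit Types (s t u r : 'S_n) (x y z a b : 'I_n) (i j : nat).
Variables p q : 'I_n.
Hypothesis pq : q = p.+1 :> nat.
Let t := tperm p q.

(** The exchange maps defects to defects, and creates one between the arcs or
    points at p and q. *)
Lemma card_defectsJ s : involutive s -> uncrossed s p q ->
  (s ^ t)%g != s -> #|defects (s ^ t)%g| = #|defects s|.+1.
Proof.
move=> sK up ts.
have [a1 a2] := adjacent_images pq sK.
(* The defect created, as seen before the exchange: it is made by the arcs at
   p and q, or by one of these arcs and a fixed point. *)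
pose e0 := if q < s q then (if s p < p then (s p, q) else (q, p))
           else (if s q < q then (s q, s p) else (s p, q)).
have qnp : q == p = false by rewrite ord_eqE; lia.
have notFF : ~~ ((s p == p) && (s q == q)).
  apply: contraNN ts => /andP[/eqP ep /eqP eq]; apply/eqP/permP=> z.
  rewrite conj_tpermE /t; case: (tpermP p q z) => [->|->|/eqP zp /eqP zq].
  - by rewrite eq tpermR ep.
  - by rewrite ep tpermL eq.
  by rewrite tpermD // -1?{1}ep -1?{1}eq (inj_eq perm_inj) eq_sym.
have mem x y : ((t x, t y) \in defects (s ^ t)%g) =
    [&& t x < t y, t y < t (s x) & (s y == y) || (t (s x) < t (s y))].
  by rewrite inE /= !permJ (inj_eq perm_inj).
have nE0 : e0 \notin defects s.
  rewrite /e0 !ord_eqE in notFF *; move/and3P: up; rewrite !ord_eqE => -[u1 u2 u3].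
  by rewrite inE; do 2?[case: ifP] => /=; rewrite ?sK ?ord_eqE; lia.
have E x y : ((t x, t y) \in defects (s ^ t)%g) =
    ((x, y) == e0) || ((x, y) \in defects s).
  have lt a b : ~~ ((a == p) && (b == q) || (a == q) && (b == p)) ->
      (t a < t b) = (a < b).
    by rewrite negb_or (tperm_lt pq) => /andP[/negPf-> /negPf->].
  have spq : s p != q by case/and3P: up.
  have sqp : s q != p by rewrite -(inj_eq (@perm_inj _ s)) sK eq_sym.
  have tsp : t (s p) = if s p == p then q else s p.
    by case: ifP => [/eqP->|/negbT h]; rewrite /t ?tpermL // tpermD // eq_sym.
  have tsq : t (s q) = if s q == q then p else s q.
    by case: ifP => [/eqP->|/negbT h]; rewrite /t ?tpermR // tpermD // eq_sym.
  move/and3P: up; rewrite !ord_eqE => -[u1 u2 u3].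
  rewrite mem inE /=.
  have [N1|N1] := boolP ((x == p) && (y == q) || (x == q) && (y == p)).
    case/orP: N1 => /andP[/eqP-> /eqP->];
    rewrite tsp tsq /e0 /t ?tpermL ?tpermR; move: u1 u2 u3 a1 a2 notFF;
    rewrite !ord_eqE; clear -pq;
    do 4?[case: ifP => ?]; rewrite ?xpair_eqE !ord_eqE; lia.
  have [N2|N2] := boolP ((y == p) && (s x == q) || (y == q) && (s x == p)).
    case/orP: N2 => /andP[/eqP-> /eqP sx];
    move/(congr1 s): sx; rewrite sK => ->; rewrite !sK;
    rewrite tsp tsq /e0 /t ?tpermL ?tpermR; move: u1 u2 u3 a1 a2 notFF;
    rewrite !ord_eqE; clear -pq;
    do 4?[case: ifP => ?]; rewrite ?xpair_eqE !ord_eqE; lia.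
  have [N3|N3] := boolP ((s x == p) && (s y == q) || (s x == q) && (s y == p)).
    case/orP: N3 => /andP[/eqP/(congr1 s) + /eqP/(congr1 s)];
    rewrite !sK => -> ->; rewrite !sK;
    rewrite tsp tsq /e0 /t ?tpermL ?tpermR; move: u1 u2 u3 a1 a2 notFF;
    rewrite !ord_eqE; clear -pq;
    do 4?[case: ifP => ?]; rewrite ?xpair_eqE !ord_eqE; lia.
  rewrite !lt //; have [e|//] := eqVneq (x, y) e0.
  by move: e N1 N2 N3; rewrite /e0; do 2?[case: ifP => _] => -[-> ->];
    rewrite ?sK !eqxx ?orbT.
have inj : injective (fun e : 'I_n * 'I_n => (t e.1, t e.2)).
  by move=> [a b] [c d] /= [/perm_inj -> /perm_inj ->].
have -> : defects (s ^ t)%g = [set (t e.1, t e.2) | e in e0 |: defects s].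
  apply/setP=> -[a b]; rewrite -[a](tpermK p q) -[b](tpermK p q).
  rewrite E -[X in _ = (X \in _)]/((fun e : 'I_n * 'I_n => (t e.1, t e.2)) (t a, t b)).
  by rewrite mem_imset // !inE.
by rewrite card_imset // cardsU1 nE0.
Qed.

End DefectsJ.

Section Descent.

Variable n : nat.
Implicit Types (s t u r : 'S_n) (x y z a b p q : 'I_n) (i j : nat).

Lemma card_ord_below i : i <= n -> #|[set x : 'I_n | x < i]| = i.
Proof.
move=> le_in; rewrite -sum1_card -{2}[i]subn0 -[i - 0]muln1 -sum_nat_const_nat.
rewrite (big_nat_widen _ _ n) // big_mkord.
by apply: eq_bigl => x; rewrite inE.
Qed.

Lemma card_ord_above j : j <= n -> #|[set x : 'I_n | j <= x]| = n - j.
Proof.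
move=> le_jn; rewrite -[n in RHS]card_ord -(cardsC [set x : 'I_n | x < j]).
rewrite card_ord_below // addKn; apply: eq_card => x; rewrite !inE; lia.
Qed.

Lemma ord_monotone (f : 'I_n -> nat) :
  (forall p q, q = p.+1 :> nat -> f p <= f q) ->
  forall x y, x <= y -> f x <= f y.
Proof.
move=> fS x [m mn] /=; elim: m mn => [|m IH] mn xm.
  by have -> : x = Ordinal mn by apply: val_inj => /=; lia.
have [e|xm'] := eqVneq (x : nat) m.+1.
  by have -> : x = Ordinal mn by apply: val_inj.
have mn' : m < n by lia.
by apply: leq_trans (IH mn' _) (fS _ _ _) => //=; lia.
Qed.

Lemma arcs_minn s i j : arcs s i j = arcs s i (minn j n).
Proof.
apply: eq_card => a; rewrite !inE.
have := ltn_ord (s a); lia.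
Qed.

(** An arc not inside [i, j) has its left end below i or its right end at or
    above j. *)
Lemma arcs_lower u i j : involutive u -> i <= n -> j <= n ->
  arcs u 0 n <= i + arcs u i j + (n - j).
Proof.
move=> uK le_in le_jn.
rewrite -{1}(card_ord_below le_in) -(card_ord_above le_jn).
rewrite -(card_imset [set x : 'I_n | j <= x] (@perm_inj _ u)).
rewrite (leq_trans _ (leq_add (leq_card_setU _ _) (leqnn _))) //.
rewrite (leq_trans _ (leq_card_setU _ _)) //.
apply/subset_leq_card/subsetP => a; rewrite !inE.
have -> : (a \in u @: [set x : 'I_n | j <= x]) = (j <= u a).
  by rewrite -{1}[a]uK (mem_imset _ _ (@perm_inj _ u)) inE.
lia.
Qed.

(** Equality case of the previous bound: all points below i are left ends, all
    points from j on are right ends, and no arc does both. *)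
Lemma arcs_upper s i j a : involutive s -> j <= n ->
    i <= a -> a < s a -> s a < j ->
    (forall x, x < i -> x < s x < j) ->
    (forall y, j <= y -> i <= s y < y) ->
  i + arcs s i j + (n - j) <= arcs s 0 n.
Proof.
move=> sK le_jn ia asa saj low high.
have le_in : i <= n by have := ltn_ord a; lia.
rewrite -{1}(card_ord_below le_in) -(card_ord_above le_jn).
rewrite -(card_imset [set x : 'I_n | j <= x] (@perm_inj _ s)).
have memI b : (b \in s @: [set x : 'I_n | j <= x]) = (j <= s b).
  by rewrite -{1}[b]sK (mem_imset _ _ (@perm_inj _ s)) inE.
have cardUd (A B : {set 'I_n}) : [disjoint A & B] -> #|A| + #|B| = #|A :|: B|.
  by move=> AB; rewrite cardsU disjoint_setI0 // cards0 subn0.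
rewrite !cardUd; first last.
- by rewrite disjoint_subset; apply/subsetP=> b; rewrite !inE ltnNge => /negPf->.
- rewrite disjoint_subset; apply/subsetP=> b; rewrite !inE memI -ltnNge.
  by case/orP=> [/low/andP[]|/and3P[]].
apply/subset_leq_card/subsetP => b; rewrite !inE memI leq0n ltn_ord andbT /=.
case/orP=> [/orP[/low/andP[]|/and3P[]]|/high] //.
by rewrite sK => /andP[].
Qed.

(** Otherwise the left ends come first, the right ends last, and both are
    matched in increasing order. This is the smallest element of the order: it
    attains the lower bound on the counts, so that s would lie below u. *)
Lemma exists_uncrossed s u : involutive s -> involutive u -> arcs_le u s ->
    u != s -> arcs u 0 n = arcs s 0 n ->
  exists p q, [/\ q = p.+1 :> nat, uncrossed s p q & (s ^ tperm p q)%g != s].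
Proof.
move=> sK uK us neq eqk.
have [/existsP[p /existsP[q /and3P[/eqP ? ? ?]]]|no] :=
  boolP [exists p : 'I_n, exists q : 'I_n,
    [&& q == p.+1 :> nat, uncrossed s p q & (s ^ tperm p q)%g != s]].
  by exists p, q.
case/eqP: neq; apply: arcs_le_anti => // i j.
(* The defaults place the right end of a point that has none after all points,
   and the left end of a point that has none before them. *)
pose H z := if z < s z then s z : nat else n.
pose G z := if s z < z then (s z).+1 else 0.
have step p q : q = p.+1 :> nat -> (H p <= H q) && (G p <= G q).
  move=> pq; apply: contraNT no => h; apply/existsP; exists p.
  apply/existsP; exists q; rewrite pq eqxx /=.
  have up : uncrossed s p q.
    move: h; rewrite /uncrossed /H /G ord_eqE; do 4?[case: ifP => ?];
    have := ltn_ord (s p); have := ltn_ord (s q); lia.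
  rewrite up; apply: contra h => /eqP/permP ss.
  have [spq _ _] := and3P up.
  have := ss p; have := ss q; have [-> ->] := conj_adjacent sK spq.
  rewrite !ord_eqE; do 2?[case: ifP => ?] => /(congr1 val)/= + /(congr1 val)/= +;
    rewrite /H /G; do 4?[case: ifP => ?]; lia.
have Hmono : forall x y, x <= y -> H x <= H y.
  by apply: ord_monotone => p q /step/andP[].
have Gmono : forall x y, x <= y -> G x <= G y.
  by apply: ord_monotone => p q /step/andP[].
rewrite (arcs_minn s) (arcs_minn u); set m := minn j n.
have le_mn : m <= n by rewrite geq_minr.
have [s0|[a]] := set_0Vmem [set a : 'I_n | [&& i <= a, a < s a & s a < m]].
  by rewrite /arcs s0 cards0.
rewrite inE => /and3P[ia asa sam].
have le_in : i <= n by have := ltn_ord a; lia.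
suff: i + arcs s i m + (n - m) <= arcs s 0 n.
  have := arcs_lower uK le_in le_mn; lia.
apply: (arcs_upper sK le_mn ia asa sam) => [x xi|y my].
  have := Hmono x a; rewrite /H asa; case: ifP => ?; have := ltn_ord (s a); lia.
have := Gmono (s a) y; rewrite /G sK asa; case: ifP => ?; lia.
Qed.

End Descent.

(** * One more defect *)

Section Graded.

Variable n : nat.
Implicit Types (s t u r : 'S_n) (x y z a b p q v w : 'I_n) (i j : nat).

Lemma arcs_linked s p q : q = p.+1 :> nat -> arcs s p q.+1 = (s p == q).
Proof.
move=> pq; rewrite arcs_row arcs_out ?addn0 ?pq // -pq ltnS ord_eqE.
by congr nat_of_bool; lia.
Qed.

(** The induction step shared by the combinatorial and the geometric
    consequences of the order: u stays below s after the exchange is made in s,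
    or in both. *)
Lemma lifting_step s u : involutive s -> involutive u -> arcs_le u s ->
    u != s -> arcs u 0 n = arcs s 0 n ->
  exists p q, [/\ q = p.+1 :> nat, uncrossed s p q, (s ^ tperm p q)%g != s &
    arcs_le u (s ^ tperm p q)%g \/
    uncrossed u p q /\ arcs_le (u ^ tperm p q)%g (s ^ tperm p q)%g].
Proof.
move=> sK uK us neq eqk.
have [p [q [pq up st]]] := exists_uncrossed sK uK us neq eqk.
exists p, q; split=> //.
have upq : u p != q.
  have := us p q.+1; rewrite !arcs_linked //.
  by case/and3P: up => /negPf-> _ _; case: eqP.
have uJ := @involutiveJ _ u p q uK.
have [up_u|up_u] := orP (uncrossed_total pq uK upq).
  by right; split=> //; apply: uncrossed_leJJ.
left; rewrite -[u](@conj_tpermK _ u p q); apply: uncrossed_leJJ => //.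
exact: uncrossed_leJ.
Qed.

Lemma uncrossed_conj_le s p q : q = p.+1 :> nat -> involutive s -> uncrossed s p q ->
  arcs_le (s ^ tperm p q)%g s.
Proof. by move=> pq sK up; apply: uncrossed_leJ. Qed.

Lemma card_defects s : #|defects s| <= n * n.
Proof. by rewrite (leq_trans (max_card _)) // card_prod !card_ord. Qed.

(** The number of defects grades the order from above. If the exchange in s
    alone does not give r, it is applied to an element r' obtained by induction
    between the exchanged u and s; whether r' is uncrossed decides if r is the
    exchanged s or the exchanged r'. *)
Lemma exists_one_more_defect s u : involutive s -> involutive u -> arcs_le u s ->
    u != s -> arcs u 0 n = arcs s 0 n ->
  exists r, [/\ involutive r, arcs_le u r, arcs_le r s
    & #|defects r| = #|defects s|.+1].
Proof.
have [m] := ubnP (n * n - #|defects s|); elim: m s u => // m IH s u.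
rewrite ltnS => sm sK uK us neq eqk.
have [p [q [pq up st alt]]] := lifting_step sK uK us neq eqk.
set t := tperm p q in st alt.
have sJ := @involutiveJ _ s p q sK; have uJ := @involutiveJ _ u p q uK.
have le_s : arcs_le (s ^ t)%g s by exact: uncrossed_conj_le.
have c_s : #|defects (s ^ t)%g| = #|defects s|.+1 by exact: card_defectsJ.
case: alt => [le_u|[up_u le_u]]; first by exists (s ^ t)%g.
have neq' : (u ^ t)%g != (s ^ t)%g by rewrite (inj_eq (@conjg_inj _ t)).
have [||r [rK ur rs cr]] := IH _ _ _ sJ uJ le_u neq'.
- by have := card_defects (s ^ t)%g; rewrite c_s; lia.
- by rewrite !arcsJ_total.
have rs' := arcs_le_trans rs le_s.
have rpq : r p != q.
  have := rs' p q.+1; rewrite !arcs_linked //.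
  by case/and3P: up => /negPf-> _ _; case: eqP.
have rJ := @involutiveJ _ r p q rK.
have [r_up|r_up] := orP (uncrossed_total pq rK rpq).
  exists (s ^ t)%g; split=> //; apply: arcs_le_trans rs.
  by rewrite -[u](@conj_tpermK _ u p q); apply: uncrossed_leJ.
have [rr|rr] := eqVneq (r ^ t)%g r.
  exists (s ^ t)%g; split=> //; apply: arcs_le_trans rs.
  rewrite -[u](@conj_tpermK _ u p q); apply: uncrossed_leJ => //.
  by rewrite -rr.
have r_le : arcs_le r (r ^ t)%g.
  by rewrite -[X in arcs_le X](@conj_tpermK _ r p q); apply: uncrossed_conj_le.
exists (r ^ t)%g; split=> //.
- rewrite -[u](@conj_tpermK _ u p q); apply: uncrossed_leJ => //.
  exact: arcs_le_trans ur r_le.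
- exact: uncrossed_leJ.
have := card_defectsJ pq rJ r_up; rewrite conj_tpermK eq_sym => /(_ rr).
by rewrite cr c_s => -[].
Qed.

End Graded.

(** * Involutions without defect are maximal *)

Section Blocks.

Variable n : nat.
Implicit Types (s t u r : 'S_n) (x y z a b p q v w : 'I_n) (i j : nat).

Lemma eq_from_arcs r s : involutive r -> involutive s ->
  arcs r 0 n = arcs s 0 n -> (forall v, v < r v -> s v = r v) -> s = r.
Proof.
move=> rK sK eqk hr; apply: involution_eq => // v vs.
pose L u := [set a : 'I_n | [&& 0 <= a, a < u a & u a < n]].
have LE u a : (a \in L u) = (a < u a) by rewrite inE ltn_ord andbT.
have sub : L r \subset L s.
  by apply/subsetP=> a; rewrite !LE => ar; rewrite hr.
have eqL : L r = L s by apply/eqP; rewrite eqEcard sub /=; move: eqk; rewrite /arcs => ->.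
by apply: hr; rewrite -LE eqL LE.
Qed.

(** A fixed point below the arc of v, or an arc leaving the interval below it,
    would be a defect involving v. *)
Lemma arc_block_full u v : involutive u -> v < u v ->
    (forall z, (v, z) \notin defects u) ->
    (forall z, (z, v) \notin defects u) ->
  forall z, v <= z <= u v -> (u z != z) && (v <= u z <= u v).
Proof.
move=> uK vuv no1 no2 z zv.
have := no1 z; have := no2 (u z); rewrite !inE /= uK.
have [e|zv1] := eqVneq z v; first by rewrite e !ord_eqE; lia.
have [->|zv2] := eqVneq z (u v); first by rewrite uK !ord_eqE; lia.
have z3 : u z != u v by rewrite (inj_eq perm_inj).
have z4 : u z != v by rewrite -(inj_eq (@perm_inj _ u)) uK.
move: zv zv1 zv2 z3 z4 vuv; rewrite !ord_eqE; clear; lia.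
Qed.

(** The count of an interval whose points are all matched inside it is as large
    as can be, hence cannot grow. *)
Lemma full_interval_transfer u s i j : involutive u -> involutive s -> arcs_le u s ->
    (forall z, i <= z < j -> (u z != z) && (i <= u z < j)) ->
  forall z, i <= z < j -> (s z != z) && (i <= s z < j).
Proof.
move=> uK sK us full.
set I := [set a : 'I_n | i <= a < j].
pose P (w : 'S_n) := [set a : 'I_n | [&& w a != a, i <= a < j & i <= w a < j]].
have uI : P u = I.
  apply/setP=> a; rewrite !inE.
  by have [/full/andP[-> ->]//|_] := boolP (i <= a < j); rewrite andbF.
have sI : P s = I.
  apply/eqP; rewrite eqEcard -{2}uI -!arcs_double // leq_double us andbT.
  by apply/subsetP=> a; rewrite !inE => /and3P[].
move=> z zI; have : z \in P s by rewrite sI inE.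
by rewrite inE => /and3P[-> _ ->].
Qed.

(** An arc free of defects bounds a full interval, so s matches its ends inside
    that interval. Were v matched to an inner point w, the arc of w would be
    shorter, hence already common to u and s unless it is bad. *)
Lemma intact_arcs_common u s (bad : pred 'I_n) : involutive u -> involutive s ->
    arcs_le u s ->
    (forall v, v < u v -> ~~ bad v ->
       forall z, (v, z) \notin defects u /\ (z, v) \notin defects u) ->
    (forall v, v < u v -> ~~ bad v -> forall w, v < w < u v -> w < u w ->
       bad w -> s w != v /\ s (u w) != v) ->
  forall v, v < u v -> ~~ bad v -> s v = u v.
Proof.
move=> uK sK us good sep v; have [m] := ubnP (u v - v).
elim: m v => // m IH v; rewrite ltnS => lev vuv gv.
have bl := arc_block_full uK vuv (fun z => (good v vuv gv z).1) (fun z => (good v vuv gv z).2).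
have bl' : forall z, v <= z < (u v).+1 -> (u z != z) && (v <= u z < (u v).+1).
  by move=> z; rewrite !ltnS; apply: bl.
have /andP[nsv] := full_interval_transfer uK sK us bl' (z := v) (ltac:(lia)).
have [w sv] : {w | s v = w} by exists (s v).
have sw : s w = v by rewrite -sv sK.
rewrite sv in nsv *; rewrite ltnS => vwu.
have [//|wuv] := eqVneq w (u v).
have vw : v < w < u v by move: vwu nsv wuv; rewrite !ord_eqE; lia.
have /andP[uww uwv] := bl w vwu.
have uwv' : v < u w < u v.
  have : u w != v by rewrite -(inj_eq (@perm_inj _ u)) uK.
  have : u w != u v by rewrite (inj_eq perm_inj); move: vw; rewrite ord_eqE; lia.
  by move: uwv; rewrite !ord_eqE; lia.
have [wuw|uww'] := boolP (w < u w).
  have [bw|gw] := boolP (bad w).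
    by have [] := sep v vuv gv w vw wuw bw; rewrite sw eqxx.
  have := IH w _ wuw gw; rewrite sw => /(_ ltac:(lia)) ->.
  by rewrite uK.
have uwlt : u w < u (u w) by move: uww uww'; rewrite uK ord_eqE; lia.
have [bw|gw] := boolP (bad (u w)).
  by have [] := sep v vuv gv (u w) uwv' uwlt bw; rewrite uK sw eqxx.
have := IH (u w) _ uwlt gw; rewrite uK => /(_ ltac:(lia)) e.
by move: (congr1 s e); rewrite sK sw => e'; rewrite -[w]uK e'.
Qed.

Lemma no_defect_maximal u s : involutive u -> involutive s -> arcs_le u s ->
  arcs u 0 n = arcs s 0 n -> defects u = set0 -> s = u.
Proof.
move=> uK sK us eqk d0; apply: eq_from_arcs => // v vuv.
apply: (@intact_arcs_common u s pred0) => // {vuv}v vuv _ z.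
by rewrite d0 !inE.
Qed.

End Blocks.

(** * Involutions with one defect *)

Section Resolution.

Variable n : nat.
Implicit Types (s t u r : 'S_n) (v w : 'I_n) (i j : nat).

Lemma arcs_le_untouched u v w i j :
    (forall a : 'I_n, i <= a -> a < u a -> u a < j ->
       [&& a != v, a != w, u a != v & u a != w]) ->
  arcs u i j <= arcs (u ^ tperm v w)%g i j.
Proof.
move=> un; apply/subset_leq_card/subsetP => a; rewrite !inE => /and3P[ia aua uaj].
have /and4P[n1 n2 n3 n4] := un a ia aua uaj.
by rewrite conj_tpermE !(tpermD, ia, aua, uaj) // eq_sym.
Qed.

Variables (u : 'S_n) (x y : 'I_n).
Hypothesis uK : involutive u.
Hypothesis xy : (x, y) \in defects u.

(** The two ways of removing the defect (x, y), where c = u x. For a crossing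
    with y joined to d, they replace the arcs (x, c), (y, d) by (x, d), (y, c)
    and by (x, y), (c, d). For a fixed point y below (x, c), they shorten that
    arc to (y, c) and to (x, y). *)
Definition nested := (u ^ tperm x y)%g.
Definition parted := (u ^ tperm y (u x))%g.

Let x_y : x < y. Proof. by move: xy; rewrite inE => /and3P[]. Qed.
Let y_c : y < u x. Proof. by move: xy; rewrite inE => /and3P[]. Qed.
Let y_d : (u y == y) || (u x < u y).
Proof. by move: xy; rewrite inE => /and3P[]. Qed.

Lemma nestedK : involutive nested. Proof. exact: involutiveJ. Qed.
Lemma partedK : involutive parted. Proof. exact: involutiveJ. Qed.

Lemma nested_y : nested y = u x.
Proof.
rewrite /nested conj_tpermE tpermR tpermD // ord_eqE; move: x_y y_c; lia.
Qed.

Lemma parted_x : parted x = y.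
Proof.
rewrite /parted conj_tpermE (@tpermD _ _ _ x) ?tpermR // ord_eqE; move: x_y y_c; lia.
Qed.

Lemma nested_x : nested x = if u y == y then x else u y.
Proof.
rewrite /nested conj_tpermE tpermL; case: ifP => [/eqP->|/negbT uyy]; first exact: tpermR.
by rewrite tpermD //; move: uyy x_y y_c y_d; rewrite !ord_eqE; lia.
Qed.

Lemma parted_c : parted (u x) = if u y == y then u x else u y.
Proof.
rewrite /parted conj_tpermE tpermR; case: ifP => [/eqP->|/negbT uyy]; first exact: tpermL.
by rewrite tpermD //; move: uyy x_y y_c y_d; rewrite !ord_eqE; lia.
Qed.

Lemma nested_other a : a != x -> a != y -> u a != x -> u a != y -> nested a = u a.
Proof. by move=> *; rewrite /nested conj_tpermE !tpermD // eq_sym. Qed.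

Lemma parted_other a : a != u x -> a != y -> a != x -> u a != y -> parted a = u a.
Proof.
move=> ? ? ax ?; rewrite /parted conj_tpermE !tpermD // eq_sym //.
by rewrite (inj_eq perm_inj).
Qed.

(** Both conjugations exchange the partners of the two crossing arcs. The second
    form serves for intervals that contain both right ends. *)
Lemma nestedE : u y != y -> nested = (u ^ tperm (u x) (u y))%g.
Proof.
move=> uyy; have yd : u x < u y by move: y_d; rewrite (negPf uyy).
apply/permP => a; rewrite /nested !conj_tpermE.
have xny : (x == y) = false by rewrite ord_eqE; move: x_y; lia.
have [->|ax] := eqVneq a x.
  rewrite tpermL !(tpermD (z := u y), tpermD (z := x)) ?tpermL //;
  rewrite !ord_eqE; move: x_y y_c yd; lia.
have [->|ay] := eqVneq a y.
  rewrite tpermR !(tpermD (z := u x), tpermD (z := y)) ?tpermR //;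
  rewrite !ord_eqE; move: x_y y_c yd; lia.
have [->|aux] := eqVneq a (u x).
  rewrite tpermL uK !(tpermD (z := u x)) ?uK ?tpermL ?(tpermD (z := y)) //;
  rewrite !ord_eqE; move: x_y y_c yd; lia.
have [->|auy] := eqVneq a (u y).
  rewrite tpermR uK !(tpermD (z := u y)) ?uK ?tpermR ?(tpermD (z := x)) //;
  rewrite !ord_eqE; move: x_y y_c yd; lia.
have e b : u a == b = (a == u b) by rewrite -(inj_eq (@perm_inj _ u)) uK.
by rewrite !(tpermD (z := a)) ?(tpermD (z := u a)) //
   eq_sym ?e ?uK // (inj_eq perm_inj).
Qed.

Lemma le_parted : arcs_le u parted.
Proof.
move=> i j; have [ij|ij] := eqVneq (i <= y < j) (i <= u x < j).
  by rewrite /parted arcsJ.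
apply: arcs_le_untouched => a ia aua uaj.
move: ij x_y y_c y_d.
have : (a != x) || (u a == u x) by case: eqVneq => [->|]; rewrite ?eqxx.
have : (a != u x) || (u a == x) by case: eqVneq => [->|]; rewrite ?uK ?eqxx.
have : (u a != u x) || (a == x) by rewrite (inj_eq perm_inj) orNb.
have : (a != y) || (u a == u y) by case: eqVneq => [->|]; rewrite ?eqxx.
have : (u a != y) || (a == u y).
  by rewrite -(inj_eq (@perm_inj _ u)) uK orNb.
rewrite !ord_eqE; move: ia aua uaj; clear; lia.
Qed.

(** An interval that separates x from y contains no arc of u at x or y, except
    when it contains the arc of y; it then contains both right ends, and
    exchanging these changes nothing. *)
Lemma le_nested : arcs_le u nested.
Proof.
move=> i j; have [ij|ij] := eqVneq (i <= x < j) (i <= y < j).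
  by rewrite /nested arcsJ.
have [/andP[uyy /andP[iy uyj]]|out] := boolP [&& u y != y, i <= y & u y < j].
  rewrite nestedE // arcsJ //; move: y_d; rewrite (negPf uyy).
  move: x_y y_c iy uyj; clear; lia.
apply: arcs_le_untouched => a ia aua uaj.
move: out ij x_y y_c y_d.
have : (a != x) || (u a == u x) by case: eqVneq => [->|]; rewrite ?eqxx.
have : (u a != x) || (a == u x).
  by rewrite -(inj_eq (@perm_inj _ u)) uK orNb.
have : (a != y) || (u a == u y) by case: eqVneq => [->|]; rewrite ?eqxx.
have : (u a != y) || (a == u y).
  by rewrite -(inj_eq (@perm_inj _ u)) uK orNb.
rewrite !ord_eqE; move: ia aua uaj; clear; lia.
Qed.

(** The intervals on which nested gains an arc separate x from y, those on
    which parted gains one separate y from u x. An interval that does both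
    contains y alone of the three points, and gains nothing. *)
Lemma arcs_min_resolutions i j : minn (arcs nested i j) (arcs parted i j) <= arcs u i j.
Proof.
have [xyE|xyN] := eqVneq (i <= x < j) (i <= y < j).
  by rewrite geq_min /nested arcsJ ?leqnn.
have [ycE|ycN] := eqVneq (i <= y < j) (i <= u x < j).
  by rewrite geq_min /parted orbC arcsJ ?leqnn.
rewrite geq_min orbC -[X in _ <= arcs X _ _](@conj_tpermK _ u y (u x)) -/parted.
rewrite arcs_le_untouched // => a ia asa saj.
have sx := parted_x; have sK := partedK.
have : (a != y) || (parted a == x) by case: eqVneq => [->|]; rewrite -?sx ?sK ?eqxx.
have : (parted a != y) || (a == x).
  by rewrite -sx (inj_eq perm_inj) orNb.
move: ia asa saj xyN ycN x_y y_c; rewrite !ord_eqE; clear; lia.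
Qed.

(** The interval from x to y contains an arc of parted at x, and nested has the
    same count there as u. *)
Lemma parted_not_le_nested : ~ arcs_le parted nested.
Proof.
move=> /(_ x y.+1); rewrite [arcs nested _ _]arcsJ //; last by move: x_y; lia.
rewrite !arcs_row parted_x; have := le_parted x.+1 y.+1.
by move: x_y y_c; clear; lia.
Qed.

Lemma nested_not_le_parted : ~ arcs_le nested parted.
Proof.
move=> /(_ y (u x).+1); rewrite [arcs parted _ _]arcsJ //; last by move: x_y y_c; lia.
rewrite !arcs_row nested_y; have := le_nested y.+1 (u x).+1.
by move: x_y y_c y_d; rewrite ord_eqE; clear; lia.
Qed.

End Resolution.

(** An involution s above u, where (x, y) is the only defect of u. All arcs of
    u other than those of the defect belong to s; the points of the defect can
    then be matched only among themselves, which leaves three possibilities. *)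
Section OneDefect.

Variable n : nat.
Implicit Types (s t r : 'S_n) (v w : 'I_n) (i j : nat).

Variables (u : 'S_n) (x y : 'I_n).
Hypothesis uK : involutive u.
Hypothesis d1 : defects u = [set (x, y)].

Let dxy : (x, y) \in defects u. Proof. by rewrite d1 inE. Qed.
Let x_y : x < y. Proof. by move: dxy; rewrite inE => /and3P[]. Qed.
Let y_c : y < u x. Proof. by move: dxy; rewrite inE => /and3P[]. Qed.
Let y_d : (u y == y) || (u x < u y).
Proof. by move: dxy; rewrite inE => /and3P[]. Qed.

Variable s : 'S_n.
Hypotheses (sK : involutive s) (us : arcs_le u s) (eqk : arcs u 0 n = arcs s 0 n).

Let good v : v < u v -> ~~ pred2 x y v ->
  forall z, (v, z) \notin defects u /\ (z, v) \notin defects u.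
Proof.
move=> vuv; rewrite negb_or => /andP[vx vy] z.
by rewrite d1 !inE !xpair_eqE (negPf vx) (negPf vy) andbF.
Qed.

Let core_block : u y != y -> forall z : 'I_n, x <= z < (u y).+1 ->
  (u z != z) && (x <= u z < (u y).+1).
Proof.
move=> uyy z zxd.
have h a b : (a, b) \in defects u -> a = x /\ b = y.
  by rewrite d1 inE => /eqP[-> ->].
have h1 := h x z; have h2 := h y z; have h3 := h (u z) x; have h4 := h (u z) y.
move: h1 h2 h3 h4; rewrite !inE /= uK.
have [->|zx] := eqVneq z x; first by move: x_y y_c y_d uyy; rewrite !ord_eqE; clear; lia.
have [->|zy] := eqVneq z y; first by move: x_y y_c y_d uyy; rewrite !ord_eqE; clear; lia.
have [->|zux] := eqVneq z (u x).
  by move: x_y y_c y_d uyy; rewrite uK !ord_eqE; clear; lia.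
have [->|zuy] := eqVneq z (u y).
  by move: x_y y_c y_d uyy; rewrite uK !ord_eqE; clear; lia.
move=> h1 h2 h3 h4.
have n1 : ~~ [&& x < z, z < u x & (u z == z) || (u x < u z)].
  by apply/negP => /h1 [_ e]; rewrite e eqxx in zy.
have n2 : ~~ [&& y < z, z < u y & (u z == z) || (u y < u z)].
  by apply/negP => /h2 [e _]; move: x_y; rewrite e ltnn.
have n3 : ~~ [&& u z < x, x < z & (u x == x) || (z < u x)].
  by apply/negP => /h3 [_ e]; move: x_y; rewrite e ltnn.
have n4 : ~~ [&& u z < y, y < z & (u y == y) || (z < u y)].
  by apply/negP => /h4 [e _]; rewrite -e uK eqxx in zux.
have e1 : (u z != x) by rewrite -(inj_eq (@perm_inj _ u)) uK.
have e2 : (u z != y) by rewrite -(inj_eq (@perm_inj _ u)) uK.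
have e3 : (u z != u x) by rewrite (inj_eq perm_inj).
have e4 : (u z != u y) by rewrite (inj_eq perm_inj).
move: n1 n2 n3 n4 e1 e2 e3 e4 zx zy zux zuy zxd x_y y_c y_d uyy; rewrite !ord_eqE; clear; lia.
Qed.

Let s_good v : v < u v -> ~~ pred2 x y v -> s v = u v.
Proof.
apply: intact_arcs_common => // {}v vuv gv w vw wuw bw.
have bl := arc_block_full uK vuv (fun z => (good vuv gv z).1) (fun z => (good vuv gv z).2).
have [vx uyy] : v < x /\ u y != y.
  have := (good vuv gv x).2; rewrite inE /=; have := bl x; have := bl y.
  move: gv vw; case/orP: bw => /eqP-> /=; move: x_y y_c y_d vuv;
  rewrite !ord_eqE; clear; lia.
have cb := full_interval_transfer uK sK us (core_block uyy).
have wI : x <= w < (u y).+1.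
  case/orP: bw => /eqP-> /=; move: x_y y_c y_d uyy; rewrite !ord_eqE; clear; lia.
have uwI : x <= u w < (u y).+1.
  case/orP: bw => /eqP-> /=; move: x_y y_c y_d uyy; rewrite !ord_eqE; clear; lia.
have := cb w wI; have := cb (u w) uwI.
by rewrite !ord_eqE; move: vx; clear; lia.
Qed.

Let s_other v : u v != v -> ~~ pred2 x y v -> ~~ pred2 x y (u v) -> s v = u v.
Proof.
move=> uvv gv guv; have [vuv|uvv'] := boolP (v < u v); first exact: s_good.
have uvl : u v < u (u v) by move: uvv uvv'; rewrite uK ord_eqE; clear; lia.
by have := s_good uvl guv; rewrite uK => e; rewrite -[in LHS]e sK.
Qed.

(** The points of the defect; if y is fixed, the last two disjuncts give u x
    and y again. *)
Let core v := [|| v == x, v == y, v == u x | v == u y].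

Let uE a b : (u a == b) = (a == u b).
Proof. by rewrite -(inj_eq (@perm_inj _ u)) uK. Qed.

Let core_s v : core v -> s v != v -> u (s v) != s v -> core (s v).
Proof.
move=> cv svv usv; apply: contraLR cv => nc; move: (nc).
rewrite /core !negb_or => /and4P[n1 n2 n3 n4].
have e : s (s v) = u (s v).
  by apply: s_other => //=; rewrite negb_or ?uE ?n1 ?n2 ?n3 ?n4.
by rewrite sK in e; rewrite e !uE !uK n1 n2 n3 n4.
Qed.

Let resolved r : involutive r -> arcs r 0 n = arcs u 0 n ->
  (forall v, ~~ core v -> r v = u v) -> (forall v, core v -> v < r v -> s v = r v) ->
  s = r.
Proof.
move=> rK rk rother rcore; apply: eq_from_arcs => //; first by rewrite rk.
move=> v; have [cv|ncv] := boolP (core v); first exact: rcore.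
rewrite rother // => vuv; apply: s_good => //=; move: ncv.
by rewrite /core !negb_or => /and4P[-> ->].
Qed.

Let xy_u : [/\ x != y, u x != y, u x != x & u y != x].
Proof.
have h : u y != x by move: x_y y_c y_d; rewrite !ord_eqE; clear; lia.
by split => //; rewrite !ord_eqE; move: x_y y_c; clear; lia.
Qed.

Let nested_same v : ~~ core v -> nested u x y v = u v.
Proof.
by rewrite /core !negb_or => /and4P[? ? ? ?]; apply: nested_other; rewrite ?uE.
Qed.

Let parted_same v : ~~ core v -> parted u x y v = u v.
Proof.
by rewrite /core !negb_or => /and4P[? ? ? ?]; apply: parted_other; rewrite ?uE.
Qed.

Lemma above_crossing : u y != y -> [\/ s = u, s = nested u x y | s = parted u x y].
Proof.
move=> uyy; have cb := full_interval_transfer uK sK us (core_block uyy).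
have inI v : core v -> x <= v < (u y).+1.
  by case/or4P => /eqP->; move: x_y y_c y_d uyy; rewrite !ord_eqE; clear; lia.
have sc v : core v -> core (s v) && (s v != v).
  move=> cv; have /andP[svv svI] := cb v (inI v cv).
  by rewrite svv core_s //; case/andP: (core_block uyy svI).
have [xny uxy uxx uyx] := xy_u.
have cx : core x by rewrite /core eqxx.
have cy : core y by rewrite /core eqxx orbT.
have cc : core (u x) by rewrite /core eqxx !orbT.
have nx := nested_x dxy; have ny := nested_y dxy.
have px := parted_x dxy; have pc := parted_c dxy.
rewrite (negPf uyy) in nx pc.
have py : parted u x y y = x by rewrite -{2}px partedK.
have pd : parted u x y (u y) = u x by rewrite -pc partedK.
have nc : nested u x y (u x) = y by rewrite -ny nestedK.
have nd : nested u x y (u y) = x by rewrite -nx nestedK.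
have /andP[/or4P[/eqP e|/eqP e|/eqP e|/eqP e] sxx] := sc x cx.
- by rewrite e eqxx in sxx.
- have sc' : s (u x) = u y.
    have /andP[/or4P[/eqP e'|/eqP e'|/eqP e'|/eqP //] n'] := sc _ cc.
    + by move: uxy; rewrite -[u x]sK e' e eqxx.
    + by move: uxx; rewrite -[u x]sK e' -e sK eqxx.
    + by rewrite e' eqxx in n'.
  constructor 3; apply: resolved; [exact: partedK|exact: arcsJ_total|exact: parted_same|].
  move=> v /or4P[] /eqP->; rewrite ?px ?pc ?py ?pd //.
  + by move: x_y y_c; clear; lia.
  by move: x_y y_c y_d uyy; rewrite !ord_eqE; clear; lia.
- have sy : s y = u y.
    have /andP[/or4P[/eqP e'|/eqP e'|/eqP e'|/eqP //] n'] := sc _ cy.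
    + by move: uxy; rewrite -e -e' sK eqxx.
    + by rewrite e' eqxx in n'.
    + by move: xny; rewrite -[x]sK e -e' sK eqxx.
  constructor 1; apply: resolved => // v /or4P[] /eqP-> //; rewrite uK.
    by move: x_y y_c; clear; lia.
  by move: x_y y_c uyy y_d; rewrite !ord_eqE; clear; lia.
- have sy : s y = u x.
    have /andP[/or4P[/eqP e'|/eqP e'|/eqP //|/eqP e'] n'] := sc _ cy.
    + by move: uyy; rewrite -e -e' sK eqxx.
    + by rewrite e' eqxx in n'.
    + by move: xny; rewrite -[x]sK e -e' sK eqxx.
  constructor 2; apply: resolved; [exact: nestedK|exact: arcsJ_total|exact: nested_same|].
  move=> v /or4P[] /eqP->; rewrite ?nx ?ny ?nc ?nd //.
  + by move: y_c; clear; lia.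
  by move: x_y y_c y_d uyy; rewrite !ord_eqE; clear; lia.
Qed.

(** The interval I from x to u x is matched inside itself by u, except y. The
    count of s is at least as large, so s leaves out at most one point of I,
    and in particular at most one of x, y, u x. *)
Lemma above_covered_point : u y == y -> [\/ s = u, s = nested u x y | s = parted u x y].
Proof.
move=> /eqP uyy; have [xny uxy uxx uyx] := xy_u.
set I := [set a : 'I_n | x <= a < (u x).+1].
pose P (w : 'S_n) := [set a : 'I_n | [&& w a != a, x <= a < (u x).+1 & x <= w a < (u x).+1]].
have uP : P u = I :\ y.
  apply/setP=> a; rewrite !inE; have [->|ay] := eqVneq a y.
    by rewrite uyy eqxx.
  have [->|ax] := eqVneq a x; first by move: x_y y_c; rewrite ord_eqE; clear; lia.
  have [->|ac] := eqVneq a (u x).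
    by move: x_y y_c; rewrite uK ord_eqE; clear; lia.
  have h1 : (x, a) \notin defects u by rewrite d1 inE xpair_eqE negb_and ay orbT.
  have h2 : (u a, x) \notin defects u.
    by rewrite d1 inE xpair_eqE negb_and xny orbT.
  have n1 : u a != x by rewrite uE.
  have n2 : u a != u x by rewrite (inj_eq perm_inj).
  by move: h1 h2 n1 n2 ax ac; rewrite !inE /= uK !ord_eqE; clear; lia.
have sP a b : a \in I -> b \in I -> a != b -> (a \in P s) || (b \in P s).
  move=> aI bI ab; apply: contraT; rewrite negb_or => /andP[aP bP].
  have sub : P s \subset (I :\ a) :\ b.
    apply/subsetP=> z zP; rewrite in_setD1 in_setD1 (contraNneq _ bP) => [|<- //].
    rewrite (contraNneq _ aP) => [|<- //].
    by move: zP; rewrite !inE => /and3P[].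
  have yI : y \in I by rewrite inE; move: x_y y_c; clear; lia.
  have := subset_leq_card sub.
  have : #|P u| <= #|P s| by rewrite -!arcs_double // leq_double us.
  rewrite uP; have := cardsD1 y I; have := cardsD1 a I.
  have := cardsD1 b (I :\ a); rewrite in_setD1 eq_sym ab aI bI yI /=.
  by clear; lia.
have xI : x \in I by rewrite inE; move: x_y y_c; clear; lia.
have yI : y \in I by rewrite inE; move: x_y y_c; clear; lia.
have cI : u x \in I by rewrite inE; move: x_y y_c; clear; lia.
have cx : core x by rewrite /core eqxx.
have cy : core y by rewrite /core eqxx orbT.
have cc : core (u x) by rewrite /core eqxx !orbT.
have inP v : core v -> v \in P s -> core (s v) && (s v != v).
  rewrite inE => cv /and3P[svv _ svI]; rewrite svv andbT.
  have [/eqP e|ne] := boolP (u (s v) == s v); last exact: core_s.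
  have : s v \notin P u by rewrite inE e eqxx.
  by rewrite uP !inE svI andbT negbK => /eqP->.
have nx := nested_x dxy; have ny := nested_y dxy.
have px := parted_x dxy; have pc := parted_c dxy.
rewrite uyy eqxx in nx pc.
have py : parted u x y y = x by rewrite -{2}px partedK.
have nc : nested u x y (u x) = y by rewrite -ny nestedK.
have [xP|xP] := boolP (x \in P s).
  have /andP[/or4P[/eqP e|/eqP e|/eqP e|/eqP e] sxx] := inP x cx xP.
  - by rewrite e eqxx in sxx.
  - constructor 3; apply: resolved; [exact: partedK|exact: arcsJ_total|exact: parted_same|].
    by move=> v /or4P[] /eqP->; rewrite ?uyy ?px ?pc ?py ?ltnn //; move: x_y; clear; lia.
  - constructor 1; apply: resolved => // v /or4P[] /eqP-> //;
      rewrite ?uK ?uyy ?ltnn //; by move: x_y y_c; clear; lia.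
  constructor 3; rewrite uyy in e.
  apply: resolved; [exact: partedK|exact: arcsJ_total|exact: parted_same|].
  by move=> v /or4P[] /eqP->; rewrite ?uyy ?px ?pc ?py ?ltnn //; move: x_y; clear; lia.
have yP : y \in P s by have := sP x y xI yI xny; rewrite (negPf xP).
have /andP[cs syy] := inP y cy yP.
have e : s y = u x.
  case/or4P: cs => /eqP e //; try by rewrite e ?uyy eqxx in syy.
  have sx : s x = y by rewrite -e sK.
  by move: xP x_y y_c; rewrite inE sx eq_sym xny; clear; lia.
constructor 2; apply: resolved; [exact: nestedK|exact: arcsJ_total|exact: nested_same|].
by move=> v /or4P[] /eqP->; rewrite ?uyy ?nx ?ny ?nc ?ltnn //; move: y_c; clear; lia.
Qed.

End OneDefect.

Section Ancestors.

Variable n : nat.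
Implicit Types (s t r u : 'S_n) (x y v w : 'I_n) (i j : nat).

Lemma above_one_defect u x y s : involutive u -> defects u = [set (x, y)] ->
    involutive s -> arcs_le u s -> arcs u 0 n = arcs s 0 n ->
  [\/ s = u, s = nested u x y | s = parted u x y].
Proof.
move=> uK d1 sK us eqk; have [uyy|uyy] := boolP (u y == y).
  exact: above_covered_point.
exact: above_crossing.
Qed.

Lemma nested_neq u x y : involutive u -> (x, y) \in defects u -> nested u x y != u.
Proof.
move=> uK d; apply/eqP => e; case: (nested_not_le_parted uK d).
by rewrite e; apply: le_parted.
Qed.

(** A defect of one resolution could be removed in turn; the result would be
    above u, hence one of u and its resolutions, which are incomparable. *)
Lemma nested_no_defect u x y : involutive u -> defects u = [set (x, y)] ->
  defects (nested u x y) = set0.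
Proof.
move=> uK d1; have d : (x, y) \in defects u by rewrite d1 inE.
have nK := nestedK x y uK.
apply/eqP; apply: contraT => /set0Pn[[v w] dn].
have le1 := le_nested nK dn.
have le2 := arcs_le_trans (le_nested uK d) le1.
have eqk : arcs u 0 n = arcs (nested (nested u x y) v w) 0 n.
  by rewrite !arcsJ_total.
have [e|e|e] := above_one_defect uK d1 (nestedK v w nK) le2 eqk.
- rewrite e in le1; case: (nested_not_le_parted uK d).
  exact: arcs_le_trans le1 (le_parted uK d).
- by have := nested_neq nK dn; rewrite e eqxx.
- by rewrite e in le1; case: (nested_not_le_parted uK d).
Qed.

Lemma parted_no_defect u x y : involutive u -> defects u = [set (x, y)] ->
  defects (parted u x y) = set0.
Proof.
move=> uK d1; have d : (x, y) \in defects u by rewrite d1 inE.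
have nK := partedK x y uK.
apply/eqP; apply: contraT => /set0Pn[[v w] dn].
have le1 := le_nested nK dn.
have le2 := arcs_le_trans (le_parted uK d) le1.
have eqk : arcs u 0 n = arcs (nested (parted u x y) v w) 0 n.
  by rewrite !arcsJ_total.
have [e|e|e] := above_one_defect uK d1 (nestedK v w nK) le2 eqk.
- rewrite e in le1; case: (parted_not_le_nested uK d).
  exact: arcs_le_trans le1 (le_nested uK d).
- by rewrite e in le1; case: (parted_not_le_nested uK d).
- by have := nested_neq nK dn; rewrite e eqxx.
Qed.

(** By the grading, the covered element u has exactly one defect; s is one
    of its two resolutions and s2 the other. *)
Lemma descendant_of_no_defect u s : involutive u -> involutive s -> arcs_le u s ->
    u != s -> arcs u 0 n = arcs s 0 n -> defects s = set0 ->
    (forall r, involutive r -> arcs_le u r -> arcs_le r s -> r = u \/ r = s) ->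
  exists s2, [/\ [/\ involutive s2, defects s2 = set0, arcs s2 0 n = arcs u 0 n & s2 != s],
    arcs_le u s2,
    forall r, involutive r -> arcs u 0 n = arcs r 0 n -> arcs_le u r ->
      [\/ r = u, r = s | r = s2] &
    forall i j, minn (arcs s i j) (arcs s2 i j) <= arcs u i j].
Proof.
move=> uK sK us neq eqk ds cover.
have [r [rK ur rs]] := exists_one_more_defect sK uK us neq eqk.
have [->|rE] := cover r rK ur rs; last by rewrite rE => /n_Sn.
rewrite ds cards0 => /eqP/cards1P[[x y] d1].
have d : (x, y) \in defects u by rewrite d1 inE.
have up := above_one_defect uK d1.
have [e|e|e] := up s sK us eqk.
- by rewrite e eqxx in neq.
- exists (parted u x y); split; last by rewrite e; apply: arcs_min_resolutions.
  + split; [exact: partedK|exact: parted_no_defect|exact: arcsJ_total|].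
    apply/eqP => e'; case: (parted_not_le_nested uK d).
    by rewrite e' e.
  + exact: le_parted.
  + by rewrite e => r' r'K eqk' ur'; apply: up.
- exists (nested u x y); split; last first.
    by move=> i j; rewrite e minnC; apply: arcs_min_resolutions.
  + rewrite e => r' r'K eqk' ur'.
    by have [] := up r' r'K ur' eqk'; [constructor 1|constructor 3|constructor 2].
  + exact: le_nested.
  + split; [exact: nestedK|exact: nested_no_defect|exact: arcsJ_total|].
    apply/eqP => e'; case: (nested_not_le_parted uK d).
    by rewrite e' e.
Qed.

End Ancestors.

(** * Tableaux and involutions without defect *)

Section TwoCycles.

Variable n : nat.
Implicit Types (s : 'S_n) (a b c j x y : 'I_n).

Lemma involutionsP s : reflect (involutive s) (s \in involutions n).
Proof.
rewrite inE; apply: (iffP eqP) => [e x|sK]; first by rewrite -permM e perm1.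
by apply/permP => x; rewrite permM perm1 sK.
Qed.

Lemma porbit_involution s a : involutive s -> porbit s a = [set a; s a].
Proof.
move=> sK; apply/setP => b; rewrite !inE; apply/porbitP/orP => [[i ->]|].
  elim: i => [|i IH]; first by left; rewrite expg0 perm1.
  by rewrite expgSr permM; case: IH => /eqP->; [right|left; rewrite sK].
by case=> /eqP->; [exists 0; rewrite expg0 perm1|exists 1; rewrite expg1].
Qed.

Lemma card_two_cycles s : involutive s ->
  #|[set c in porbits s | #|c| == 2]| = arcs s 0 n.
Proof.
move=> sK.
have inj : {in [set a : 'I_n | [&& 0 <= a, a < s a & s a < n]] &,
    injective (porbit s)}.
  move=> a b; rewrite !inE => /and3P[_ asa _] /and3P[_ bsb _] e.
  have : a \in porbit s b by rewrite -e porbit_id.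
  rewrite porbit_involution // !inE => /orP[/eqP//|/eqP e'].
  by move: asa bsb; rewrite e' sK; lia.
rewrite /arcs -(card_in_imset inj); apply: eq_card => c.
rewrite inE; apply/andP/imsetP => [[/imsetP[a _ ->]]|[a]].
  rewrite porbit_involution // cards2 eqSS eqb1 => asa.
  have [lt|ge] := boolP (a < s a).
    by exists a; rewrite ?porbit_involution // inE lt ltn_ord.
  exists (s a); last by rewrite porbit_involution // sK setUC.
  by rewrite inE sK ltn_ord andbT /=; move: asa ge; rewrite ord_eqE; lia.
rewrite inE => /and3P[_ asa _] ->; split; first exact: imset_f.
by rewrite porbit_involution // cards2 ord_eqE neq_ltn asa.
Qed.

Lemma involutions_rankP k s :
  reflect (involutive s /\ arcs s 0 n = k) (s \in involutions_rank n k).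
Proof.
rewrite inE; apply: (iffP andP) => [[/involutionsP sK]|[sK <-]].
  by rewrite card_two_cycles // => /eqP.
by rewrite card_two_cycles //; split; first exact/involutionsP.
Qed.

Lemma arcs_right s : involutive s -> arcs s 0 n = #|[set j | s j < j]|.
Proof.
move=> sK; rewrite /arcs -(card_imset _ (@perm_inj _ s)); apply: eq_card => j.
by rewrite -[j]sK (mem_imset _ _ (@perm_inj _ s)) !inE sK ltn_ord andbT.
Qed.

(** The left end joined to j is the greatest point below j that is neither a
    right end nor joined to a smaller right end: a greater one would be fixed
    below the arc of j, or would start an arc crossing it. *)
Lemma no_defect_eq (s t : 'S_n) : involutive s -> involutive t ->
    defects s = set0 -> defects t = set0 ->
    (forall j, (s j < j) = (t j < j)) -> s = t.
Proof.
move=> sK tK ds dt R.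
have noD (u : 'S_n) x y : defects u = set0 ->
    ~~ [&& x < y, y < u x & (u y == y) || (u x < u y)].
  by move=> d0; have := in_set0 (x, y); rewrite -d0 inE /= => ->.
have eR m j : j < m -> s j < j -> s j = t j.
  elim: m j => // m IH j jm sj; have tj := sj; rewrite R in tj.
  have [lt|gt|/val_inj//] := ltngtP (s j) (t j).
    have := noD s (s j) (t j) ds; rewrite lt sK tj /= negb_or => /andP[n1 n2].
    have stj : s (t j) < j.
      move: n2; rewrite -leqNgt leq_eqVlt => /orP[/eqP/val_inj e|//].
      by move: lt; rewrite -{1}e sK ltnn.
    have h : ~~ (s (t j) < t j) by rewrite R tK -leqNgt ltnW.
    have h2 : s (s (t j)) < s (t j) by move: n1 h; rewrite sK ord_eqE; lia.
    have := IH (s (t j)) _ h2; rewrite sK => /(_ ltac:(lia)) e.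
    by move: stj; rewrite -[s (t j)]tK -e tK ltnn.
  have := noD t (t j) (s j) dt; rewrite gt tK sj /= negb_or => /andP[n1 n2].
  have tsj : t (s j) < j.
    move: n2; rewrite -leqNgt leq_eqVlt => /orP[/eqP/val_inj e|//].
    by move: gt; rewrite -{1}e tK ltnn.
  have h : ~~ (t (s j) < s j) by rewrite -R sK -leqNgt ltnW.
  have h2 : t (t (s j)) < t (s j) by move: n1 h; rewrite tK ord_eqE; lia.
  have h3 : s (t (s j)) < t (s j) by rewrite R.
  have := IH (t (s j)) _ h3; rewrite tK => /(_ ltac:(lia)) e.
  by move: tsj; rewrite -[t (s j)]sK e sK ltnn.
apply: (involution_eq tK sK) => v vv.
  have := eR n (t v) (ltn_ord _); rewrite R tK vv => /(_ isT) e.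
  by rewrite -{1}e sK.
have := eR n (s v) (ltn_ord _); rewrite sK vv => /(_ isT) e.
by rewrite {2}e tK.
Qed.

End TwoCycles.

Section Greedy.

Variable n : nat.
Implicit Types (cs used js : seq 'I_n) (ps : seq ('I_n * 'I_n)) (d i j x y : 'I_n).

Lemma prod_tperm ps : uniq (unzip1 ps ++ unzip2 ps) ->
  let s := (\prod_(p <- ps) tperm p.1 p.2)%g in
  (forall p, p \in ps -> s p.1 = p.2 /\ s p.2 = p.1) /\
  (forall x, x \notin unzip1 ps ++ unzip2 ps -> s x = x).
Proof.
elim: ps => [|[a b] ps IH] /=; first by split=> // x _; rewrite big_nil perm1.
move=> un; have : uniq [:: a, b & unzip1 ps ++ unzip2 ps].
  rewrite -(perm_uniq (s1 := a :: unzip1 ps ++ b :: unzip2 ps)) //.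
  by rewrite perm_cons -[b :: unzip2 ps]cat1s perm_catCA.
rewrite /= inE negb_or -!andbA => /and4P[ab a_ps b_ps /IH[IH1 IH2]].
rewrite big_cons /=; set s := (\prod_(p <- ps) _)%g in IH1 IH2 *.
have out x : x \notin a :: unzip1 ps ++ b :: unzip2 ps ->
    [/\ a != x, b != x & x \notin unzip1 ps ++ unzip2 ps].
  rewrite inE mem_cat inE !negb_or mem_cat negb_or => /and3P[xa x1 /andP[xb x2]].
  by rewrite eq_sym xa eq_sym xb x1 x2.
have in_ps p : p \in ps -> p.1 \in unzip1 ps ++ unzip2 ps /\ p.2 \in unzip1 ps ++ unzip2 ps.
  by move=> pps; rewrite !mem_cat (map_f fst pps) (map_f snd pps) orbT.
have nm z x : z \notin unzip1 ps ++ unzip2 ps -> x \in unzip1 ps ++ unzip2 ps -> z != x.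
  by move=> zn xn; apply: contraNneq zn => ->.
split=> [p|x /out[ax bx xn]]; last by rewrite permM tpermD // IH2.
rewrite inE => /orP[/eqP->|pps] /=.
  by rewrite !permM tpermL tpermR !IH2.
have [h1 h2] := in_ps p pps; have [e1 e2] := IH1 p pps.
by rewrite !permM !tpermD ?nm.
Qed.

Definition greedy_choice cs used j i :=
  [/\ i \in cs, i \notin used, i < j
    & forall d, d \in cs -> d \notin used -> d < j -> d <= i].

(** The property of the pairs (i_s, j_s) that makes no distinction between s = 1
    and s > 1: j_1 - 1 is also the greatest entry of the first column below
    j_1. *)
Fixpoint greedy cs used ps : Prop :=
  if ps is (i, j) :: ps' then greedy_choice cs used j i /\ greedy cs (i :: used) ps'
  else True.

Lemma greedy_mem cs used ps : greedy cs used ps ->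
  [/\ {subset unzip1 ps <= cs}, uniq (unzip1 ps),
      forall d, d \in unzip1 ps -> d \notin used
    & forall p, p \in ps -> p.1 < p.2].
Proof.
elim: ps used => [|[i j] ps IH] used //= [[ic iu ij _] /IH[sub un nu lt]].
split.
- by move=> d; rewrite inE => /orP[/eqP->|/sub].
- by rewrite un andbT; apply/negP => /nu; rewrite inE eqxx.
- move=> d; rewrite inE => /orP[/eqP->//|/nu]; by rewrite inE negb_or => /andP[].
by move=> p; rewrite inE => /orP[/eqP->|/lt].
Qed.

(** When j is given its partner i, the entries of the first column between i
    and j have all been used for smaller right ends. *)
Lemma greedy_gap cs used ps : greedy cs used ps ->
    sorted ltn [seq val j | j <- unzip2 ps] ->
  forall p d, p \in ps -> d \in cs -> p.1 < d < p.2 -> d \notin used ->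
  exists2 p', p' \in ps & p'.1 = d /\ p'.2 < p.2.
Proof.
elim: ps used => [|[i j] ps IH] used //= [[ic iu ij imax] gr] srt p d.
rewrite inE => /orP[/eqP->|pps] dc /= pd du.
  by have := imax d dc du; lia.
have [di|di] := eqVneq d i.
  exists (i, j); rewrite ?inE ?eqxx //=; split=> //.
  have := order_path_min ltn_trans srt; move/allP; apply.
  by apply: map_f; apply: map_f.
have [|p' p'ps [e lt]] := IH (i :: used) gr (path_sorted srt) p d pps dc pd.
  by rewrite inE negb_or di.
by exists p'; rewrite ?inE ?p'ps ?orbT.
Qed.

Lemma tableau_pairs_snd cs used js : unzip2 (tableau_pairs cs used js) = js.
Proof. by elim: js used => //= j js IH used; rewrite IH. Qed.

(** The default value j of arg max does not satisfy the condition, but it is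
    returned only if no d does. *)
Lemma arg_max_choice cs used j :
    (exists d, [&& d \in cs, d \notin used & d < j]) ->
  greedy_choice cs used j
    [arg max_(d > j | [&& d \in cs, d \notin used & d < j]) (d : nat)].
Proof.
move=> [d0 Pd0]; pose P := [pred d | [&& d \in cs, d \notin used & d < j]].
rewrite /arg_max /extremum; case: pickP => [i /andP[/and3P[ic iu ij] /forallP imax]|no].
  split=> // d dc du dj; have := imax d; rewrite /= dc du dj /=.
  exact.
case: (@arg_maxnP _ d0 P (fun d : 'I_n => d : nat) Pd0) => i Pi imax.
have /negP[] := negbT (no i); rewrite /= (Pi : is_true [&& _, _ & _]) /=.
by apply/forallP => d; apply/implyP => /imax.
Qed.

(** An entry is available for each j: by the row condition of the tableau, the
    first column has more entries below j than have been used. *)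
Lemma greedy_tail cs used js : 0 < size used ->
    (forall t, t < size js -> exists S : seq 'I_n,
       [/\ uniq S, {subset S <= cs}, size used + t < size S
          & forall d, d \in S -> d < nth 0 (map val js) t]) ->
  greedy cs used (tableau_pairs cs used js).
Proof.
elim: js used => //= j js IH used u0 H; split.
  have [S [unS Sc szS Slt]] := H 0 isT; rewrite addn0 /= in szS Slt.
  have [d dS du] : exists2 d, d \in S & d \notin used.
    apply/hasP; rewrite -[has _ _]negbK -all_predC; apply/negP => /allP all_in.
    have : size S <= size used by apply: uniq_leq_size => // d /all_in /=; rewrite negbK.
    by rewrite leqNgt szS.
  case: used u0 {IH H szS} du => // u0 used _ du.
  by apply: arg_max_choice; exists d; rewrite Sc // du Slt.
apply: IH => // t tjs; have [S [unS Sc szS Slt]] := H t.+1 tjs.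
by exists S; split=> //=; rewrite addSnnS.
Qed.

Lemma tableau_greedy k (T : tableau n k) : 2 * k <= n ->
  greedy (Defs.col1 T) [::] (tableau_pairs (Defs.col1 T) [::] (col2 T)).
Proof.
move=> kn; case: T => cs c2 entries srt1 srt2 rows /=.
have szc1 : size cs = n - k by rewrite size_tuple.
have szc2 : size c2 = k by rewrite size_tuple.
have un1 : uniq cs.
  by have := enum_uniq 'I_n; rewrite -(perm_uniq entries) cat_uniq => /and3P[].
have first_entries t : t < k -> exists S : seq 'I_n,
    [/\ uniq S, {subset S <= cs}, t < size S
       & forall d, d \in S -> d < nth 0 (map val c2) t].
  move=> tk; exists (take t.+1 cs); split.
  - exact: take_uniq.
  - by move=> d /mem_take.
  - by rewrite size_takel // szc1; lia.
  move=> d dS; apply: leq_ltn_trans (rows t tk).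
  have dc := mem_take dS.
  have it : index d cs <= t.
    by rewrite -ltnS -(in_take _ dc).
  have -> : (d : nat) = nth 0 (map val cs) (index d cs).
    by rewrite (nth_map d) ?index_mem // nth_index.
  apply: (sorted_leq_nth leq_trans leqnn 0) => //; rewrite ?inE ?size_map ?index_mem //.
  - by apply: sub_sorted srt1 => ? ?; apply: ltnW.
  - by rewrite szc1; lia.
move: first_entries srt2 szc2; case: (tval c2) entries => [|j js] //= entries fe srt2 szc2.
have j0 : 0 < j.
  have [|S [_ _ S0 Sj]] := fe 0; first by lia.
  by case: S S0 Sj => // d S _ /(_ d); rewrite inE eqxx => /(_ isT); apply: leq_trans.
(* The first pair: nothing but entries of the first column precedes j_1. *)
have predj : ord_pred j = j.-1 :> nat.
  rewrite /= -(prednK j0) addSn /= modnDr modn_small //.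
  by have := ltn_ord j; lia.
have jmin i : i \in j :: js -> j <= i.
  rewrite inE => /orP[/eqP->//|ijs]; apply: ltnW.
  by have := order_path_min ltn_trans srt2; move/allP; apply; apply: map_f.
split.
  split=> //; last by move=> d _ _; rewrite predj; lia.
    have : ord_pred j \in cs ++ j :: js by rewrite (perm_mem entries) mem_enum.
    by rewrite mem_cat => /orP[//|/jmin]; rewrite predj; lia.
  by rewrite predj; lia.
apply: greedy_tail => // t tjs; have [|S [unS Sc szS Slt]] := fe t.+1.
  by rewrite -szc2.
by exists S; split.
Qed.

Lemma tableau_permP k (T : tableau n k) : 2 * k <= n ->
  [/\ involutive (tableau_perm T), defects (tableau_perm T) = set0
    & forall j, (tableau_perm T j < j) = (j \in (col2 T : seq 'I_n))].
Proof.
move=> kn; have gr := tableau_greedy T kn.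
set ps := tableau_pairs _ _ _ in gr.
have snd_ps : unzip2 ps = col2 T by apply: tableau_pairs_snd.
have [sub un _ lt] := greedy_mem gr.
have un_entries : uniq (Defs.col1 T ++ col2 T).
  by rewrite (perm_uniq (tableau_entries T)) enum_uniq.
have un_ps : uniq (unzip1 ps ++ unzip2 ps).
  move: un_entries; rewrite !cat_uniq un snd_ps => /and3P[_ /hasPn dis ->].
  by rewrite andbT /=; apply/hasPn => d /dis; apply: contra => /sub.
have srt : sorted ltn [seq val j | j <- unzip2 ps] by rewrite snd_ps; apply: tableau_col2.
have [] := prod_tperm un_ps; rewrite -/(tableau_perm T); set s := tableau_perm T => sps sout.
have cases x : [\/ exists2 p, p \in ps & x = p.1, exists2 p, p \in ps & x = p.2
    | x \notin unzip1 ps ++ unzip2 ps].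
  have [|xn] := boolP (x \in unzip1 ps ++ unzip2 ps); last by constructor 3.
  rewrite mem_cat => /orP[/mapP[p pps e]|/mapP[p pps e]].
    by constructor 1; exists p.
  by constructor 2; exists p.
have sK : involutive s.
  move=> x; have [[p pps ->]|[p pps ->]|xn] := cases x; last by rewrite !sout.
    by have [e1 e2] := sps p pps; rewrite e1.
  by have [e1 e2] := sps p pps; rewrite e2.
have in_c1 d : d \notin unzip2 ps -> d \in (Defs.col1 T : seq 'I_n).
  have : d \in Defs.col1 T ++ col2 T by rewrite (perm_mem (tableau_entries T)) mem_enum.
  by rewrite mem_cat -snd_ps => /orP[//|->].
split=> //.
  apply/eqP; apply: contraT => /set0Pn[[x y]]; rewrite inE /= => /and3P[xy yx yd].
  have [p pps xp] : exists2 p, p \in ps & x = p.1.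
    have [//|[p pps e]|xn] := cases x.
      by have [_ e2] := sps p pps; have := lt p pps; rewrite e e2 in xy yx *; lia.
    by rewrite sout // in yx; lia.
  have [e1 _] := sps p pps; rewrite xp e1 in xy yx yd.
  have yc : y \in (Defs.col1 T : seq 'I_n).
    apply: in_c1; apply/mapP => -[p' p'ps e]; have [_ e2] := sps p' p'ps.
    have := lt p' p'ps; move: yx yd; rewrite e e2 ord_eqE.
    by move: (p'.1 : nat) (p'.2 : nat) (p.2 : nat); clear; lia.
  have [|p' p'ps [e lt']] := greedy_gap gr srt pps yc _ isT.
    by rewrite xy yx.
  have [e' _] := sps p' p'ps; have := lt p' p'ps; move: yd lt'.
  rewrite -e e' ord_eqE.
  by move: (p'.1 : nat) (p'.2 : nat) (p.2 : nat); clear; lia.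
move=> j; rewrite -snd_ps; have [[p pps ->]|[p pps ->]|jn] := cases j.
- have [-> _] := sps p pps; rewrite ltnNge ltnW ?lt //=; apply/esym/negP => h.
  have : p.1 \in unzip1 ps by apply: map_f.
  by move: un_ps; rewrite cat_uniq => /and3P[_ /hasPn/(_ _ h)/negP].
- have [_ ->] := sps p pps; rewrite lt //; apply/esym; exact: map_f.
rewrite sout // ltnn; apply/esym/negbTE; move: jn.
by rewrite mem_cat negb_or => /andP[].
Qed.

End Greedy.

Section ExistsTableau.

Variable n : nat.
Implicit Types (s : 'S_n) (d i j x y : 'I_n).

Lemma sorted_filter_enum (P : pred 'I_n) :
  sorted ltn [seq val d | d <- filter P (enum 'I_n)].
Proof.
rewrite sorted_map; apply: sorted_filter; first by move=> ? ? ?; apply: ltn_trans.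
by rewrite -sorted_map val_enum_ord iota_ltn_sorted.
Qed.

(** The second column lists the right ends, the first one the other points. The
    rows increase because the partners of the t + 1 first right ends are entries
    of the first column, smaller than the last of these right ends. *)
Lemma exists_tableau k s : 2 * k <= n -> involutive s -> defects s = set0 ->
  arcs s 0 n = k -> exists T : tableau n k, tableau_perm T = s.
Proof.
move=> kn sK ds ks.
pose P := [pred j | s j < j].
pose rs := filter P (enum 'I_n); pose ls := filter (predC P) (enum 'I_n).
have szr : size rs == k.
  by rewrite -ks arcs_right // cardsE cardE /rs enumT.
have entries : perm_eq (ls ++ rs) (enum 'I_n).
  by rewrite perm_catC perm_filterC.
have szl : size ls == n - k.
  have := perm_size entries; rewrite size_cat (eqP szr) size_enum_ord => nE.
  by rewrite -(eqn_add2r k) nE subnK //; lia.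
have srtl : sorted ltn [seq val d | d <- ls] by exact: sorted_filter_enum.
have srtr : sorted ltn [seq val d | d <- rs] by exact: sorted_filter_enum.
have rows t : t < k -> nth 0 [seq val d | d <- ls] t < nth 0 [seq val d | d <- rs] t.
  move=> tk; rewrite ltnNge; apply/negP => le_t.
  have memr j : (j \in rs) = (s j < j) by rewrite mem_filter mem_enum andbT.
  have meml j : (j \in ls) = ~~ (s j < j) by rewrite mem_filter mem_enum andbT.
  have tsz : t < size rs by rewrite (eqP szr).
  pose A := [seq s j | j <- take t.+1 rs].
  have szA : size A = t.+1 by rewrite size_map size_takel.
  have unA : uniq A.
    rewrite map_inj_uniq; last exact: perm_inj.
    by apply: take_uniq; apply: filter_uniq; apply: enum_uniq.
  suff sub : {subset A <= take t ls}.
    have := uniq_leq_size unA sub; rewrite szA size_takel ?ltnn // (eqP szl); lia.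
  move=> _ /mapP[j jt ->].
  have jr := mem_take jt; have sj : s j < j by rewrite -memr.
  have sjl : s j \in ls by rewrite meml sK -leqNgt ltnW.
  rewrite in_take // ltnNge; apply/negP => ti.
  have ij : index j rs <= t by rewrite -ltnS -in_take.
  have le1 : nth 0 [seq val d | d <- ls] t <= s j.
    have -> : (s j : nat) = nth 0 [seq val d | d <- ls] (index (s j) ls).
      by rewrite (nth_map j) ?index_mem // nth_index.
    apply: (sorted_leq_nth leq_trans leqnn 0) => //; rewrite ?inE ?size_map ?index_mem //.
    + by apply: sub_sorted srtl => ? ?; apply: ltnW.
    + by rewrite (eqP szl); lia.
  have le2 : j <= nth 0 [seq val d | d <- rs] t.
    have -> : (j : nat) = nth 0 [seq val d | d <- rs] (index j rs).
      by rewrite (nth_map j) ?index_mem // nth_index.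
    apply: (sorted_leq_nth leq_trans leqnn 0) => //; rewrite ?inE ?size_map ?index_mem //.
    by apply: sub_sorted srtr => ? ?; apply: ltnW.
  lia.
pose T := @Tableau n k (Tuple szl) (Tuple szr) entries srtl srtr rows.
have [tK dt tR] := tableau_permP T kn.
exists T; apply: no_defect_eq => // j.
by rewrite tR /= mem_filter mem_enum andbT.
Qed.

End ExistsTableau.

From mathcomp Require Import boolp classical_sets.
From mathcomp Require mpoly.
Import(canonicals) mpoly.

Import GRing.Theory Num.Theory.

Local Open Scope ring_scope.

(** * Zariski closures and curves *)

Section PolynomialFunctions.

Local Open Scope classical_set_scope.

Variables (F : fieldType) (n : nat).
Implicit Types (f g : 'M[F]_n -> F) (X Y : set 'M[F]_n) (x y : 'M[F]_n).

Definition polyfun f := exists p, forall x, mx_eval p x = f x.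

Lemma polyfun_const c : polyfun (fun=> c).
Proof. by exists (mpoly.mpolyC _ c) => x; rewrite /mx_eval mpoly.mevalC. Qed.

Lemma polyfun_coord i j : polyfun (fun x => x i j).
Proof.
exists (mpoly.mpolyX _ (mpoly.mnm1 (mxvec_index i j))) => x.
by rewrite /mx_eval mpoly.mevalXU mxvecE.
Qed.

Lemma polyfunD f g : polyfun f -> polyfun g -> polyfun (fun x => f x + g x).
Proof.
move=> [p pf] [q qg]; exists (p + q) => x.
by rewrite -pf -qg /mx_eval mpoly.mevalD.
Qed.

Lemma polyfunM f g : polyfun f -> polyfun g -> polyfun (fun x => f x * g x).
Proof.
move=> [p pf] [q qg]; exists (p * q) => x.
by rewrite -pf -qg /mx_eval mpoly.mevalM.
Qed.

Lemma polyfun_sum (I : Type) (r : seq I) (f : I -> 'M[F]_n -> F) :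
  (forall i, polyfun (f i)) -> polyfun (fun x => \sum_(i <- r) f i x).
Proof.
move=> pf; elim: r => [|i r IH].
  by under eq_fun do rewrite big_nil; apply: polyfun_const.
by under eq_fun do rewrite big_cons; apply: polyfunD.
Qed.

Lemma polyfun_prod (I : Type) (r : seq I) (f : I -> 'M[F]_n -> F) :
  (forall i, polyfun (f i)) -> polyfun (fun x => \prod_(i <- r) f i x).
Proof.
move=> pf; elim: r => [|i r IH].
  by under eq_fun do rewrite big_nil; apply: polyfun_const.
by under eq_fun do rewrite big_cons; apply: polyfunM.
Qed.

Lemma polyfunX f k : polyfun f -> polyfun (fun x => f x ^+ k).
Proof.
move=> pf; elim: k => [|k IH].
  by under eq_fun do rewrite expr0; apply: polyfun_const.
by under eq_fun do rewrite exprS; apply: polyfunM.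
Qed.

Lemma mx_evalE (p : mpoly.mpoly (n * n) F) x : mx_eval p x =
  \sum_(m <- mpoly.msupp p) mpoly.mcoeff m p *
     \prod_(l <- index_enum 'I_(n * n)) mxvec x 0 l ^+ mpoly.fun_of_multinom m l.
Proof. exact: mpoly.mevalE. Qed.

Lemma polyfun_comp p (L : 'M[F]_n -> 'M[F]_n) :
  (forall i j, polyfun (fun x => L x i j)) -> polyfun (fun x => mx_eval p (L x)).
Proof.
move=> pL; under eq_fun do rewrite mx_evalE.
apply: polyfun_sum => m; apply: polyfunM; first exact: polyfun_const.
apply: polyfun_prod => l; apply: polyfunX.
by case/mxvec_indexP: l => i j; under eq_fun do rewrite mxvecE.
Qed.

Lemma polyfun_mulmx (L : 'M[F]_n -> 'M[F]_n) (a b : 'M[F]_n) :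
  (forall i j, polyfun (fun x => L x i j)) ->
  (forall i j, polyfun (fun x => (a *m L x *m b) i j)).
Proof.
move=> pL i j; under eq_fun do rewrite mxE.
apply: polyfun_sum => k; apply: polyfunM; last exact: polyfun_const.
under eq_fun do rewrite mxE.
by apply: polyfun_sum => l; apply: polyfunM => //; apply: polyfun_const.
Qed.

Lemma zariski_closureP X x : zariski_closure X x <->
  forall p, (forall y, X y -> mx_eval p y = 0) -> mx_eval p x = 0.
Proof.
split=> [clx p pX|H Z [[P ->] XZ] p Pp]; last first.
  by apply: H => y /XZ; apply.
apply: (clx [set y | mx_eval p y = 0]); split=> //.
exists [set p]; apply/seteqP; split=> y /=; first by move=> h q ->.
exact.
Qed.

Lemma closure_polyfun X f x : polyfun f -> (forall y, X y -> f y = 0) ->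
  zariski_closure X x -> f x = 0.
Proof.
move=> [p pf] fX /zariski_closureP clx.
by rewrite -pf clx // => y /fX; rewrite pf.
Qed.

Lemma subset_zariski_closure X : X `<=` zariski_closure X.
Proof. by move=> x Xx; apply/zariski_closureP => p; apply. Qed.

Lemma zariski_closure_sub X Y : X `<=` zariski_closure Y ->
  zariski_closure X `<=` zariski_closure Y.
Proof.
move=> XY x /zariski_closureP clx; apply/zariski_closureP => p pY.
by apply: clx => y /XY/zariski_closureP; apply.
Qed.

Lemma closure_conj X Y (a b : 'M[F]_n) :
  (forall y, X y -> zariski_closure Y (a *m y *m b)) ->
  forall x, zariski_closure X x -> zariski_closure Y (a *m x *m b).
Proof.
move=> XY x clx; apply/zariski_closureP => p pY.
apply: (closure_polyfun (f := fun x => mx_eval p (a *m x *m b))) clx.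
  apply: polyfun_comp => i j; apply: (polyfun_mulmx (L := id)) => {i j} i j.
  exact: polyfun_coord.
by move=> y /XY/zariski_closureP; apply.
Qed.

Lemma closed_closure Z X : zariski_closed Z -> X `<=` Z ->
  zariski_closure X `<=` Z.
Proof. by move=> cZ XZ x; apply; split. Qed.

Lemma zariski_closedN Z x : zariski_closed Z -> ~ Z x ->
  exists p, (forall y, Z y -> mx_eval p y = 0) /\ mx_eval p x <> 0.
Proof.
move=> [P ->] /= /existsNP[p /not_implyP[Pp px]].
by exists p; split=> // y; apply.
Qed.

End PolynomialFunctions.

Section Curves.

Local Open Scope classical_set_scope.

Variables (F : numFieldType) (n : nat).
Implicit Types (X Y : set 'M[F]_n) (g h x y : 'M[F]_n).

Lemma exists_nonroot (P : {poly F}) : P != 0 -> exists t, P.[t] != 0.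
Proof.
move=> P0; pose rs := [seq i%:R : F | i <- iota 0 (size P)].
have : ~~ all (root P) rs.
  apply/negP => allP; have := max_poly_roots P0 allP.
  rewrite size_map size_iota ltnn map_inj_uniq ?iota_uniq; first by move/(_ isT).
  by move=> i j /eqP; rewrite eqr_nat => /eqP.
by case/allPn => t _ rt; exists t.
Qed.

Definition conj_mx g y := g *m y *m invmx g.

(** Along a curve with entries A / D, a polynomial function becomes a polynomial
    in t once multiplied by a power of the denominator D. *)
Lemma homogenize (D : {poly F}) (A : 'M[{poly F}]_n) (x : F -> 'M[F]_n) p :
    (forall t, D.[t] != 0 -> forall i j, (A i j).[t] = D.[t] * x t i j) ->
  exists (P : {poly F}) d, forall t, D.[t] != 0 ->
    P.[t] = D.[t] ^+ d * mx_eval p (x t).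
Proof.
move=> Ax.
pose H (f : F -> F) := exists (P : {poly F}) d, forall t, D.[t] != 0 ->
  P.[t] = D.[t] ^+ d * f t.
have Hc c : H (fun=> c).
  by exists c%:P, 0%N => t _; rewrite hornerC expr0 mul1r.
have Hadd f1 f2 : H f1 -> H f2 -> H (fun t => f1 t + f2 t).
  move=> [P1 [d1 h1]] [P2 [d2 h2]]; exists (D ^+ d2 * P1 + D ^+ d1 * P2), (d1 + d2)%N.
  move=> t Dt; rewrite hornerD !hornerM !horner_exp h1 // h2 // exprD mulrDr.
  by rewrite !mulrA [_ ^+ d2 * _]mulrC.
have Hmul f1 f2 : H f1 -> H f2 -> H (fun t => f1 t * f2 t).
  move=> [P1 [d1 h1]] [P2 [d2 h2]]; exists (P1 * P2), (d1 + d2)%N.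
  by move=> t Dt; rewrite hornerM h1 // h2 // exprD mulrACA.
have Hexp f k : H f -> H (fun t => f t ^+ k).
  move=> Hf; elim: k => [|k IH].
    by under eq_fun do rewrite expr0; apply: Hc.
  by under eq_fun do rewrite exprS; apply: Hmul.
have Hsum (I : Type) (r : seq I) f : (forall i, H (f i)) -> H (fun t => \sum_(i <- r) f i t).
  move=> Hf; elim: r => [|i r IH].
    by under eq_fun do rewrite big_nil; apply: Hc.
  by under eq_fun do rewrite big_cons; apply: Hadd.
have Hprod (I : Type) (r : seq I) f : (forall i, H (f i)) -> H (fun t => \prod_(i <- r) f i t).
  move=> Hf; elim: r => [|i r IH].
    by under eq_fun do rewrite big_nil; apply: Hc.
  by under eq_fun do rewrite big_cons; apply: Hmul.
suff : H (fun t => mx_eval p (x t)) by [].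
under eq_fun do rewrite mx_evalE.
apply: Hsum => m; apply: Hmul; first exact: Hc.
apply: Hprod => l; apply: Hexp; case/mxvec_indexP: l => i j.
by exists (A i j), 1%N => t Dt; rewrite mxvecE expr1 Ax.
Qed.

Lemma conj_curve g h y p : exists (P : {poly F}) d, forall t,
  \det (g + t *: h) != 0 ->
  P.[t] = \det (g + t *: h) ^+ d * mx_eval p (conj_mx (g + t *: h) y).
Proof.
pose G : 'M[{poly F}]_n := map_mx polyC g + 'X *: map_mx polyC h.
have Gt t : map_mx (horner_eval t) G = g + t *: h.
  apply/matrixP => i j; rewrite !mxE /= /horner_eval hornerD hornerM hornerX !hornerC.
  by [].
have Dt t : (\det G).[t] = \det (g + t *: h).
  by rewrite -Gt det_map_mx.
pose A := G *m map_mx polyC y *m \adj G.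
have [|P [d Pd]] := @homogenize (\det G) A (fun t => conj_mx (g + t *: h) y) p.
  move=> t; rewrite Dt => Dn i j.
  have -> : (A i j).[t] = map_mx (horner_eval t) A i j by rewrite [RHS]mxE.
  rewrite /A !map_mxM map_mx_adj Gt.
  have -> : map_mx (horner_eval t) (map_mx polyC y) = y.
    by apply/matrixP => a b; rewrite !mxE /= /horner_eval hornerC.
  rewrite /conj_mx /invmx unitmxE unitfE Dn -scalemxAr [in RHS]mxE.
  by rewrite mulrA divff // mul1r.
by exists P, d => t Dn; rewrite Pd Dt.
Qed.

Lemma det_curve g h : exists D : {poly F}, forall t, D.[t] = \det (g + t *: h).
Proof.
exists (\det (map_mx polyC g + 'X *: map_mx polyC h)) => t.
rewrite -[LHS]/(horner_eval t _) -det_map_mx; congr (\det _).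
apply/matrixP => i j; rewrite !mxE /= /horner_eval hornerD hornerM hornerX !hornerC.
by [].
Qed.

(** If a line through an invertible g conjugates y into X for all but finitely
    many parameters, it does so up to closure at g itself. *)
Lemma curve_closure X g h y (P0 : {poly F}) : g \in unitmx -> P0 != 0 ->
    (forall t, P0.[t] != 0 -> g + t *: h \in unitmx ->
       X (conj_mx (g + t *: h) y)) ->
  zariski_closure X (conj_mx g y).
Proof.
rewrite unitmxE unitfE => gu P0n HX; apply/zariski_closureP => p pX.
have [P [d Pd]] := conj_curve g h y p; have [D Dd] := det_curve g h.
apply/eqP; apply: contraT => pg.
have D0 : D.[0] != 0 by rewrite Dd scale0r addr0.
have P00 : P.[0] != 0.
  by rewrite Pd ?scale0r ?addr0 // mulf_neq0 // expf_neq0.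
have [|t] := @exists_nonroot (P * D * P0).
  rewrite !mulf_neq0 //.
    by apply: contraNneq P00 => ->; rewrite horner0.
  by apply: contraNneq D0 => ->; rewrite horner0.
rewrite !hornerM !mulf_eq0 !negb_or => /andP[/andP[Pt Dt] P0t].
rewrite Dd in Dt; move: Pt; rewrite Pd // pX ?mulr0 ?eqxx //.
by apply: HX => //; rewrite unitmxE unitfE.
Qed.

(** Two points of the orbit lie on the image of a line; a polynomial not
    vanishing at one and a polynomial not vanishing at the other are both
    nonzero at a common point of this curve. *)
Lemma irreducible_conj y (B : set 'M[F]_n) :
    (forall g h t, B g -> B h -> g + t *: (h - g) \in unitmx -> B (g + t *: (h - g))) ->
    (forall g, B g -> g \in unitmx) ->
  forall Y Z, zariski_closed Y -> zariski_closed Z ->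
    [set conj_mx g y | g in B] `<=` Y `|` Z ->
  [set conj_mx g y | g in B] `<=` Y \/ [set conj_mx g y | g in B] `<=` Z.
Proof.
move=> BL Bu Y Z cY cZ BYZ; apply: contrapT => /not_orP[].
move=> /nonsubset[_ [[g Bg <-] nY]] /nonsubset[_ [[h Bh <-] nZ]].
have [p [pY pg]] := zariski_closedN cY nY.
have [q [qZ qh]] := zariski_closedN cZ nZ.
have [P [d Pd]] := conj_curve g (h - g) y p.
have [Q [e Qe]] := conj_curve g (h - g) y q.
have [D Dd] := det_curve g (h - g).
have := Bu _ Bg; have := Bu _ Bh; rewrite !unitmxE !unitfE => hu gu.
have gh1 : g + 1 *: (h - g) = h by rewrite scale1r addrC subrK.
have gh0 : g + 0 *: (h - g) = g by rewrite scale0r addr0.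
have D0 : D.[0] != 0 by rewrite Dd gh0.
have P00 : P.[0] != 0.
  by rewrite Pd gh0 // mulf_neq0 ?expf_neq0 //; apply/eqP.
have Q1 : Q.[1] != 0.
  by rewrite Qe gh1 // mulf_neq0 ?expf_neq0 //; apply/eqP.
have [|t] := @exists_nonroot (P * D * Q).
  rewrite !mulf_neq0 //.
  - by apply: contraNneq P00 => ->; rewrite horner0.
  - by apply: contraNneq D0 => ->; rewrite horner0.
  by apply: contraNneq Q1 => ->; rewrite horner0.
rewrite !hornerM !mulf_eq0 !negb_or => /andP[/andP[Pt Dt] Qt].
rewrite Dd in Dt; rewrite Pd // in Pt; rewrite Qe // in Qt.
have : B (g + t *: (h - g)) by apply: BL; rewrite // unitmxE unitfE.
move=> Bt; have : [set conj_mx g y | g in B] (conj_mx (g + t *: (h - g)) y).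
  by exists (g + t *: (h - g)).
move=> /BYZ[/pY e0|/qZ e0]; first by rewrite e0 mulr0 eqxx in Pt.
by rewrite e0 mulr0 eqxx in Qt.
Qed.

End Curves.

(** * Closures of orbits *)

Section Orbits.

Variables (F : numFieldType) (n : nat).
Implicit Types (g h b x y : 'M[F]_n) (s u : 'S_n).

Lemma conj_mx_eq b x y : b \in unitmx -> x *m b = b *m y -> x = conj_mx b y.
Proof. by move=> bu e; rewrite /conj_mx -e mulmxK. Qed.

Lemma conj_mxM g b y : g \in unitmx -> b \in unitmx ->
  conj_mx g (conj_mx b y) = conj_mx (g *m b) y.
Proof.
move=> gu bu; apply: conj_mx_eq; first by rewrite unitmx_mul gu.
by rewrite /conj_mx mulmxA mulmxKV // -!mulmxA mulVmx // mulmx1.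
Qed.

Lemma conj_mx1 y : conj_mx 1%:M y = y.
Proof. by rewrite /conj_mx invmx1 mul1mx mulmx1. Qed.

Lemma borelP b : borel b <-> (forall i j : 'I_n, (j < i)%N -> b i j = 0) /\ b \in unitmx.
Proof.
split=> -[h bu]; split=> //.
  by move=> i j ji; move/is_trig_mxP: h => /(_ j i ji); rewrite mxE.
by apply/is_trig_mxP => i j ij; rewrite mxE h.
Qed.

Lemma borel1 : borel (1%:M : 'M[F]_n).
Proof.
apply/borelP; split; last exact: unitmx1.
by move=> i j ji; rewrite mxE (_ : (i == j) = false) // ord_eqE; lia.
Qed.

Lemma inv_mx_orbit s : @borel_orbit F n s (inv_mx F s).
Proof. by exists 1%:M; [exact: borel1|exact: conj_mx1]. Qed.

Section Parabolic.

Variables p q : 'I_n.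
Hypothesis pq : q = p.+1 :> nat.

(** The minimal parabolic subgroup of the adjacent points p and q, without the
    invertibility condition. *)
Definition parabolic g :=
  forall i j : 'I_n, (j < i)%N -> ~~ ((i == q) && (j == p)) -> g i j = 0.

Lemma borel_parabolic b : borel b -> parabolic b.
Proof. by move=> /borelP[h _] i j ji _; apply: h. Qed.

Lemma parabolicM g b : parabolic g -> borel b -> parabolic (g *m b).
Proof.
move=> gP /borelP[bB _] i j ji nij; rewrite mxE big1 // => m _.
have [jm|mj] := ltnP j m; first by rewrite bB ?mulr0.
rewrite gP ?mul0r //; first by lia.
by move: nij; rewrite !ord_eqE; lia.
Qed.

Lemma parabolic_tperm : parabolic (tperm_mx p q).
Proof.
move=> i j ji nij; rewrite !mxE /=; case: eqP => // e.
by move: nij ji; rewrite -e; case: tpermP => [->|->|_ _]; rewrite ?eqxx ?ltnn // pq; lia.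
Qed.

Lemma inv_mxJ s : involutive s -> s p != q ->
  inv_mx F (s ^ tperm p q)%g = conj_mx (tperm_mx p q) (inv_mx F s).
Proof.
move=> sK spq; have tu : tperm_mx p q \in @unitmx F n by exact: unitmx_perm.
apply: conj_mx_eq => //; rewrite /tperm_mx -row_permE.
rewrite -[X in _ *m perm_mx X]invgK -col_permE.
apply/matrixP => i j; rewrite !mxE tpermV.
rewrite conj_tpermE (inj_eq perm_inj); congr (_%:R); congr nat_of_bool.
set t := tperm p q; have [e|_] := eqVneq (s (t i)) j; last by rewrite !andbF.
rewrite !andbT -e -{1}(tpermK p q i) -/t (tperm_lt pq).
set a := t i; have sa : s q != p by rewrite -(inj_eq (@perm_inj _ s)) sK eq_sym.
have pq0 : (p == q) = false by rewrite ord_eqE; lia.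
have [->|_] := eqVneq a p; first by rewrite (negPf spq) pq0.
by have [->|_] := eqVneq a q; first by rewrite (negPf sa).
Qed.

Lemma mulmx_delta y (a c i j : 'I_n) : (y *m delta_mx a c) i j = y i a * (j == c)%:R.
Proof.
rewrite mxE (bigD1 a) //= big1 ?addr0 => [|k /negPf ka]; rewrite !mxE ?eqxx //.
by rewrite ka mulr0.
Qed.

Lemma delta_mulmx y (a c i j : 'I_n) : (delta_mx a c *m y) i j = (i == a)%:R * y c j.
Proof.
rewrite mxE (bigD1 c) //= big1 ?addr0 => [|k /negPf kb]; rewrite !mxE ?eqxx ?andbT //.
by rewrite kb andbF mul0r.
Qed.

(** The elementary matrix in position (q, p), corrected by a second one so that
    it commutes with N_s. *)
Definition shear s (e : bool) : 'M[F]_n :=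
  delta_mx q p + e%:R *: delta_mx (s q) (s p).

(** With e true exactly if p and q are both left ends or both right ends. In
    the other uncrossed configurations row p and column q of N_s vanish. *)
Lemma uncrossed_centralizer s : involutive s -> uncrossed s p q ->
  exists2 e : bool, e ==> ((s q < s p)%N && (s p != p)) &
   inv_mx F s *m shear s e = shear s e *m inv_mx F s.
Proof.
move=> sK up; have [a1 a2] := adjacent_images pq sK.
have N i j : (s i == j) = (i == s j) by rewrite -(inj_eq (@perm_inj _ s)) sK.
exists ((p < s p) || (s q < q))%N.
  by move: up; rewrite /uncrossed !ord_eqE; clear; lia.
rewrite /shear mulmxDr mulmxDl -scalemxAr -scalemxAl.
have dE (y : 'M[F]_n) (e : F) z i j : (y + e *: z) i j = y i j + e * z i j.
  by rewrite !mxE.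
apply/matrixP => i j; rewrite !dE !mulmx_delta !delta_mulmx !mxE.
rewrite -!natrM -!natrD; congr (_%:R).
rewrite !mulnb sK (inj_eq perm_inj) (N i q) ![s p == j]eq_sym ![p == j]eq_sym.
move: up a1 a2; rewrite /uncrossed !ord_eqE; clear -pq.
by do 4![case: eqVneq => ?]; lia.
Qed.

Lemma shear_inv s e : s q != p -> s p != q ->
  forall t, (1%:M - t *: shear s e) *m (1%:M + t *: shear s e) = 1%:M.
Proof.
move=> sqp spq t; have S2 : shear s e *m shear s e = 0.
  rewrite /shear mulmxDr !mulmxDl -!scalemxAr -!scalemxAl.
  have pnq : p != q by rewrite ord_eqE; lia.
  by rewrite !mul_delta_mx_0 ?scaler0 ?addr0 ?(inj_eq perm_inj) // eq_sym.
rewrite mulmxDr mulmx1 mulmxBl mul1mx -scalemxAl -scalemxAr S2 !scaler0 subr0.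
by rewrite subrK.
Qed.

(** The orbit of N_s under the parabolic subgroup is essentially that of the
    Borel subgroup: an element g with a nonzero entry at (q, q) becomes upper
    triangular on multiplying it by an element of the centralizer of N_s. *)
Lemma parabolic_conj g s : involutive s -> uncrossed s p q ->
  parabolic g -> g \in unitmx -> g q q != 0 -> @borel_orbit F n s (conj_mx g (inv_mx F s)).
Proof.
move=> sK up gP gu gqq; have [e he comm] := uncrossed_centralizer sK up.
have spq : s p != q by case/and3P: up.
have sqp : s q != p by rewrite -(inj_eq (@perm_inj _ s)) sK eq_sym.
(* This multiple of the shear cancels the entry of g at (q, p). *)
pose t := g q p / g q q; pose c := 1%:M - t *: shear s e.
have cu : c \in unitmx by have [] := mulmx1_unit (shear_inv e sqp spq t).
have bu : g *m c \in unitmx by rewrite unitmx_mul gu.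
exists (g *m c); last first.
  symmetry; apply: conj_mx_eq => //.
  rewrite /conj_mx mulmxA mulmxKV // -!mulmxA; congr (_ *m _).
  by rewrite /c mulmxBr mulmxBl mul1mx mulmx1 -scalemxAr -scalemxAl comm.
apply/borelP; split=> // i j ji.
have gz (a a' : 'I_n) : (a' < a)%N -> ~~ ((a == q) && (a' == p)) -> g a a' = 0 by exact: gP.
rewrite /c mulmxBr mulmx1 -scalemxAr /shear mulmxDr -scalemxAr.
have -> : (g - t *: (g *m delta_mx q p + e%:R *: (g *m delta_mx (s q) (s p)))) i j =
  g i j - t * (g i q * (j == p)%:R + e%:R * (g i (s q) * (j == s p)%:R)).
  by rewrite -!mulmx_delta !mxE.
have -> : e%:R * (g i (s q) * (j == s p)%:R) = 0.
  case: e he {c cu bu comm} => [/andP[h1 h2]|_]; last by rewrite mul0r.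
  case: eqP => [e|_]; last by rewrite !mulr0.
  by rewrite gz ?mul0r ?mulr0 ?negb_and ?sqp ?orbT //; move: ji; rewrite e; lia.
rewrite addr0; have [jE|jp] := eqVneq j p; last first.
  by rewrite mulr0 mulr0 subr0 gz // negb_and jp orbT.
rewrite mulr1 {}jE in ji *; have [->|iq] := eqVneq i q; first by rewrite /t divfK // subrr.
rewrite !gz ?mulr0 ?subr0 ?negb_and ?iq //.
by move: ji iq; rewrite !ord_eqE; clear -pq; lia.
Qed.

Local Open Scope classical_set_scope.

Lemma parabolic_closure g s : involutive s -> uncrossed s p q ->
  parabolic g -> g \in unitmx ->
  zariski_closure (@borel_orbit F n s) (conj_mx g (inv_mx F s)).
Proof.
move=> sK up gP gu.
apply: (@curve_closure F n (@borel_orbit F n s) g (1%:M - g) (inv_mx F s)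
  ((g q q)%:P + (1 - g q q) *: 'X) gu) => [|t Pt tu].
  apply/eqP => /(congr1 (fun P => P.[1])); rewrite hornerE hornerC hornerZ hornerX.
  by rewrite horner0 mulr1 addrC subrK => /eqP; rewrite oner_eq0.
apply: parabolic_conj => //.
  move=> i j ji nij; rewrite !mxE gP // add0r subr0.
  by rewrite (_ : (i == j) = false) ?mulr0 // ord_eqE; lia.
by move: Pt; rewrite hornerD hornerC hornerZ hornerX !mxE eqxx mulrC.
Qed.

(** The closure of the orbit of an uncrossed s is stable under the parabolic
    subgroup, since its general element preserves the orbit. *)
Lemma closure_parabolic g s x : involutive s -> uncrossed s p q ->
    parabolic g -> g \in unitmx -> zariski_closure (@borel_orbit F n s) x ->
  zariski_closure (@borel_orbit F n s) (conj_mx g x).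
Proof.
move=> sK up gP gu; apply: closure_conj => _ [b bB <-].
have bu : b \in unitmx by case/borelP: bB.
rewrite -/(conj_mx b _) -/(conj_mx g _) conj_mxM //.
apply: parabolic_closure => //; last by rewrite unitmx_mul gu.
exact: parabolicM.
Qed.

Lemma orbit_closure_parabolic s u : involutive s -> uncrossed s p q ->
  zariski_closure (@borel_orbit F n s) (inv_mx F u) ->
  @borel_orbit F n u `<=` zariski_closure (@borel_orbit F n s).
Proof.
move=> sK up cl _ [b bB <-]; apply: closure_parabolic => //.
  exact: borel_parabolic.
by case/borelP: bB.
Qed.

End Parabolic.

Local Open Scope classical_set_scope.

(** Induction by the exchange of adjacent points: the orbits of s and of its
    conjugate have the same image under the parabolic subgroup, which contains
    the matrix of the exchange. *)
Lemma arcs_le_closure s u : involutive s -> involutive u -> arcs_le u s ->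
  arcs u 0 n = arcs s 0 n -> @borel_orbit F n u `<=` zariski_closure (@borel_orbit F n s).
Proof.
have [m] := ubnP (n * n - #|defects s|); elim: m s u => // m IH s u.
rewrite ltnS => sm sK uK us eqk.
have [->|neq] := eqVneq u s; first exact: subset_zariski_closure.
have [p [q [pq up st alt]]] := lifting_step sK uK us neq eqk.
set t := tperm p q in st alt.
have tu : tperm_mx p q \in @unitmx F n by exact: unitmx_perm.
have sJ := @involutiveJ _ s p q sK; have uJ := @involutiveJ _ u p q uK.
have less : (n * n - #|defects (s ^ t)%g| < m)%N.
  have := card_defects (s ^ t)%g; rewrite (card_defectsJ pq sK up st).
  by move: sm; lia.
have cl_s : @borel_orbit F n (s ^ t)%g `<=` zariski_closure (@borel_orbit F n s).
  apply: (orbit_closure_parabolic pq sK up); rewrite inv_mxJ //; last by case/and3P: up.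
  apply: (closure_parabolic pq) => //; first exact: parabolic_tperm.
  by apply: subset_zariski_closure; apply: inv_mx_orbit.
case: alt => [le_u|[up_u le_u]].
  by apply: subset_trans (zariski_closure_sub cl_s); apply: IH; rewrite ?arcsJ_total.
apply: (orbit_closure_parabolic pq sK up).
have upq : u p != q by case/and3P: up_u.
have -> : inv_mx F u = conj_mx (tperm_mx p q) (inv_mx F (u ^ t)%g).
  rewrite inv_mxJ // conj_mxM // -perm_mxM tperm2 perm_mx1 conj_mx1 //.
apply: (closure_parabolic pq) => //; first exact: parabolic_tperm.
apply: (zariski_closure_sub cl_s); apply: IH (inv_mx_orbit _) => //.
by rewrite !arcsJ_total.
Qed.

End Orbits.

(** * Rank conditions *)

Section RankOfInvolutionMatrix.

Variables (F : fieldType) (n : nat).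
Implicit Types (s u : 'S_n).

(** The nonzero rows are distinct unit vectors. *)
Lemma rank_mxsub_inv m (f : 'I_m -> 'I_n) s : injective f ->
  \rank (mxsub f f (inv_mx F s)) =
  #|[set a : 'I_m | (f a < s (f a))%N && [exists b, f b == s (f a)]]|.
Proof.
move=> f_inj; set A := mxsub _ _ _; set G := [set a | _].
pose g a := odflt a [pick b | f b == s (f a)].
have gP a : a \in G -> f (g a) = s (f a).
  rewrite inE /g => /andP[_ /existsP[b fb]].
  by case: pickP => [c /eqP//|/(_ b)]; rewrite fb.
have rowA a : a \in G -> row a A = 'e_(g a).
  move=> aG; apply/rowP => b; rewrite !mxE /= -gP // (inj_eq f_inj) eq_sym.
  case: eqVneq => [->|_]; rewrite ?andbF // gP // andbT.
  by move: aG; rewrite inE => /andP[-> _].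
have rowA0 a : a \notin G -> row a A = 0.
  move=> aG; apply/rowP => b; rewrite !mxE.
  case: andP => // -[h /eqP e]; case/negP: aG; rewrite inE e h /=.
  by apply/existsP; exists b.
have g_inj : {in [pred a | a \in G] &, injective g}.
  move=> a b aG bG e; apply: f_inj; apply: (@perm_inj _ s).
  by rewrite -!gP // e.
have -> : \rank A = \rank (\sum_(a | a \in G) <<('e_(g a) : 'rV[F]_m)>>)%MS.
  apply/eqmx_rank/andP; split.
    apply/row_subP => a; have [aG|aG] := boolP (a \in G); last by rewrite rowA0 // sub0mx.
    by rewrite rowA // (sumsmx_sup a) // genmxE.
  by apply/sumsmx_subP => a aG; rewrite genmxE -rowA // row_sub.
have := mxdirect_delta F g_inj; rewrite mxdirectE /= => /eqP->.
rewrite -sum1_card; apply: eq_bigr => a _.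
by rewrite mxrank_gen mxrank_delta.
Qed.

Lemma rank_mxE s (i j : 'I_n) : rank_mx F s i j = arcs s i j.+1.
Proof.
rewrite /rank_mx; case: ltnP => [ij|ji]; last by rewrite arcs_out.
rewrite /interval_submx rank_mxsub_inv; last exact: enum_val_inj.
rewrite /arcs -(card_imset _ (@enum_val_inj _ _)); apply: eq_card => a.
apply/imsetP/idP => [[b]|].
  rewrite !inE => /andP[h /existsP[c /eqP e]] ->; rewrite h -e ltnS /=.
  have := enum_valP b; have := enum_valP c; rewrite !inE => /andP[_ ->] /andP[-> _].
  by [].
rewrite inE ltnS => /and3P[ia asa saj].
have aI : a \in [set m : 'I_n | (i <= m <= j)%N].
  by rewrite inE ia /=; lia.
have saI : s a \in [set m : 'I_n | (i <= m <= j)%N].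
  by rewrite inE saj andbT; lia.
exists (enum_rank_in aI a); rewrite ?enum_rankK_in // inE enum_rankK_in // asa /=.
by apply/existsP; exists (enum_rank_in saI (s a)); rewrite enum_rankK_in.
Qed.

Lemma rank_inv_mx s : \rank (inv_mx F s) = arcs s 0 n.
Proof.
have -> : inv_mx F s = mxsub id id (inv_mx F s) by apply/matrixP => i j; rewrite !mxE.
rewrite rank_mxsub_inv //; apply: eq_card => a; rewrite !inE ltn_ord andbT.
by case: ltnP => //= _; apply/existsP; exists (s a).
Qed.

Lemma inv_leP u s : reflect (arcs_le u s) (inv_le F u s).
Proof.
apply: (iffP forallP) => [h i j|h i]; last first.
  by apply/forallP => j; rewrite !rank_mxE.
rewrite (arcs_minn u) (arcs_minn s); set m := minn j n.
have [ni|ni] := leqP n i; first by rewrite arcs_out // (leq_trans (geq_minr _ _)) // leqW.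
have [m0|m0] := posnP m; first by rewrite m0 arcs_out.
have mn : (m.-1 < n)%N by rewrite prednK // geq_minr.
have := forallP (h (Ordinal ni)) (Ordinal mn).
by rewrite !rank_mxE /= prednK.
Qed.

End RankOfInvolutionMatrix.

Section RankConditions.

Variables (F : numFieldType) (n : nat).
Implicit Types (b x y : 'M[F]_n) (s u : 'S_n).

Definition upper (k : nat) x := forall i j : 'I_n, (j < i + k)%N -> x i j = 0.

Lemma upperM k x y : upper k x -> upper 0 y -> upper k (x *m y).
Proof.
move=> xU yU i j ji; rewrite mxE big1 // => m _.
have [mi|im] := ltnP m (i + k); first by rewrite xU ?mul0r.
by rewrite yU ?mulr0 // addn0 (leq_trans ji).
Qed.

Lemma upperMr k x y : upper 0 x -> upper k y -> upper k (x *m y).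
Proof.
move=> xU yU i j ji; rewrite mxE big1 // => m _.
have [mi|im] := ltnP m i; first by rewrite xU ?mul0r ?addn0.
by rewrite yU ?mulr0 // (leq_trans ji) // leq_add2r.
Qed.

Lemma borel_upper b : borel b <-> upper 0 b /\ b \in unitmx.
Proof.
split=> [/borelP[bU bu]|[bU bu]]; first by split=> // i j; rewrite addn0; apply: bU.
by apply/borelP; split=> // i j ji; rewrite bU ?addn0.
Qed.

Lemma borelM b y : borel b -> borel y -> borel (b *m y).
Proof.
move=> /borel_upper[bU bu] /borel_upper[yU yu]; apply/borel_upper.
by rewrite unitmx_mul bu; split=> //; apply: upperM.
Qed.

Lemma upper_diag_neq0 b (i : 'I_n) : borel b -> b i i != 0.
Proof.
move=> /borelP[bU bu]; have : is_trig_mx b^T.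
  by apply/is_trig_mxP => j k jk; rewrite mxE bU.
move=> /det_trig; rewrite det_tr => db; move: bu; rewrite unitmxE unitfE db.
move=> /prodf_neq0 /(_ i isT); by rewrite mxE.
Qed.

(** The entries of the inverse below the diagonal vanish from the last row
    up. *)
Lemma borelV b : borel b -> borel (invmx b).
Proof.
move=> bB; apply/borelP; rewrite unitmx_inv; have /borelP[bU bu] := bB; split=> //.
suff H m (i j : 'I_n) : (n - i <= m)%N -> (j < i)%N -> invmx b i j = 0.
  by move=> i j; apply: (H n); rewrite leq_subr.
elim: m i => [|m IH] i im ji; first by have := ltn_ord i; lia.
have : (b *m invmx b) i j = 0.
  by rewrite mulmxV // mxE (_ : (i == j) = false) // ord_eqE; lia.
rewrite mxE (bigD1 i) //= big1 => [/eqP|k ki].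
  by rewrite addr0 mulf_eq0 (negPf (upper_diag_neq0 i bB)) => /eqP.
have [lt_ki|lt_ik] := ltnP k i; first by rewrite bU ?mul0r.
by rewrite IH ?mulr0 //; move: ki im ji; rewrite ord_eqE; lia.
Qed.

Lemma upper_conj k b x : borel b -> upper k x -> upper k (conj_mx b x).
Proof.
move=> bB xU; have /borel_upper[bU _] := bB.
have /borel_upper[vU _] := borelV bB.
by apply: upperM => //; apply: upperMr.
Qed.

Lemma upper_inv_mx s : upper 1 (inv_mx F s).
Proof.
move=> i j; rewrite addn1 ltnS => ji; rewrite mxE.
by rewrite ltnNge ji.
Qed.

Lemma upperW x : upper 1 x -> upper 0 x.
Proof. by move=> xU i j ji; rewrite xU // addn1 -(addn0 i) ltnW. Qed.

Lemma interval_submxM i j x y : upper 0 x -> upper 0 y ->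
  interval_submx i j (x *m y) = interval_submx i j x *m interval_submx i j y.
Proof.
move=> xU yU; apply/matrixP => a c; rewrite !mxE.
pose G m := x (enum_val a) m * y m (enum_val c).
rewrite (eq_bigr (fun k => G (enum_val k))); last by move=> k _; rewrite !mxE.
rewrite -(big_enum_val G) /= [LHS](bigID (mem [set m : 'I_n | (i <= m <= j)%N])) /=.
rewrite [X in _ + X]big1 ?addr0 // => m; rewrite inE negb_and -!ltnNge.
have := enum_valP a; have := enum_valP c; rewrite !inE => /andP[_ cj] /andP[ia _].
case/orP => h; first by rewrite xU ?mul0r // addn0 (leq_trans h).
by rewrite yU ?mulr0 // addn0 (leq_ltn_trans cj).
Qed.

Lemma polyfun_det m (L : 'M[F]_n -> 'M[F]_m) :
  (forall i j, polyfun (fun x => L x i j)) -> polyfun (fun x => \det (L x)).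
Proof.
move=> pL; rewrite /determinant; apply: polyfun_sum => w; apply: polyfunM.
  exact: polyfun_const.
exact: polyfun_prod.
Qed.

(** If the submatrix of x had rank r larger than that of N_s, it would have an
    invertible product P A Q of size r; the determinant of this product is a
    polynomial that vanishes on the orbit. *)
Lemma closure_rank s x (i j : 'I_n) :
  zariski_closure (@borel_orbit F n s) x ->
  (\rank (interval_submx i j x) <= \rank (interval_submx i j (inv_mx F s)))%N.
Proof.
move=> clx; rewrite leqNgt; apply/negP => lt_r.
set A := interval_submx i j x in lt_r.
have [P PC] := row_fullP (col_base_full A).
have [Q RQ] := row_freeP (row_base_free A).
pose f y := \det (P *m interval_submx i j y *m Q).
have : f x = 0.
  apply: (closure_polyfun _ _ clx).
    apply: polyfun_det => a c; under eq_fun do rewrite mxE.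
    apply: polyfun_sum => k; apply: polyfunM; last exact: polyfun_const.
    under eq_fun do rewrite mxE; apply: polyfun_sum => l.
    apply: polyfunM; first exact: polyfun_const.
    by under eq_fun do rewrite mxE; apply: polyfun_coord.
  move=> _ [b bB <-]; apply/eqP; rewrite -[_ == 0]negbK -unitfE -unitmxE.
  rewrite -row_free_unit; apply/negP => /eqP rk; move: lt_r; rewrite -{1}rk.
  have /borel_upper[bU _] := bB; have /borel_upper[vU _] := borelV bB.
  have NU := upperW (upper_inv_mx s).
  rewrite !interval_submxM //; last exact: upperM.
  rewrite ltnNge (leq_trans (mxrankM_maxl _ _)) // (leq_trans (mxrankM_maxr _ _)) //.
  by rewrite (leq_trans (mxrankM_maxl _ _)) // mxrankM_maxr.
(* A is the product of its column and row bases, which P and Q invert. *)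
have PAQ : P *m (col_base A *m row_base A) *m Q = 1%:M.
  by rewrite mulmxA PC mul1mx.
rewrite mulmx_base in PAQ; rewrite /f -/A PAQ det1.
by move/eqP; rewrite oner_eq0.
Qed.

Lemma closure_upper s x : zariski_closure (@borel_orbit F n s) x -> upper 1 x.
Proof.
move=> clx i j ji; apply: (closure_polyfun (f := fun y : 'M[F]_n => y i j) _ _ clx).
  exact: polyfun_coord.
by move=> _ [b bB <-]; apply: (upper_conj bB (upper_inv_mx s)).
Qed.

Lemma rank_conj b x : b \in unitmx -> \rank (conj_mx b x) = \rank x.
Proof.
move=> bu; rewrite /conj_mx mxrankMfree ?row_free_unit ?unitmx_inv //.
by rewrite -mxrank_tr trmx_mul mxrankMfree ?mxrank_tr // row_free_unit unitmx_tr.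
Qed.

Lemma closure_arcs_le s u : zariski_closure (@borel_orbit F n s) (inv_mx F u) ->
  arcs_le u s.
Proof.
move=> cl; apply/(inv_leP F)/forallP => i; apply/forallP => j.
rewrite /rank_mx; case: ifP => // _; exact: closure_rank.
Qed.

End RankConditions.

(** * Normal form of square-zero matrices *)

Section NormalForm.

Variables (F : numFieldType) (n : nat).
Implicit Types (b d x y z : 'M[F]_n) (s u : 'S_n).

Definition strict_square_zero y := upper 1 y /\ y *m y = 0.

Definition columns_normal m s y :=
  [/\ involutive s, (forall j : 'I_n, (m <= j)%N -> s j = j)
    & forall i j : 'I_n, (j < m)%N -> y i j = inv_mx F s i j].

Lemma conj_invK d y : d \in unitmx -> conj_mx d (conj_mx (invmx d) y) = y.
Proof. by move=> du; rewrite conj_mxM ?unitmx_inv // mulmxV // conj_mx1. Qed.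

Lemma strict_square_zero_conj d y : borel d -> strict_square_zero y ->
  strict_square_zero (conj_mx d y).
Proof.
move=> dB [yU yy]; split; first exact: upper_conj.
have du : d \in unitmx by case/borelP: dB.
rewrite /conj_mx !mulmxA mulmxKV // -[d *m y *m y]mulmxA yy.
by rewrite mulmx0 mul0mx.
Qed.

Lemma invmxM b d : b \in unitmx -> d \in unitmx ->
  invmx (b *m d) = invmx d *m invmx b.
Proof.
move=> bu du; have bdu : b *m d \in unitmx by rewrite unitmx_mul bu.
have e : invmx d *m invmx b *m (b *m d) = 1%:M.
  by rewrite -mulmxA mulKmx // mulVmx.
by rewrite -[RHS](mulmxK bdu) e mul1mx.
Qed.

(** Columns of the conjugate by d can be computed without inverting d. *)
Lemma conj_column d y z (j : 'I_n) : d \in unitmx ->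
    (forall i, (d *m z) i j = (y *m d) i j) ->
  forall i, conj_mx (invmx d) y i j = z i j.
Proof.
move=> du e i; rewrite /conj_mx invmxK -mulmxA.
rewrite -[z in RHS](mulKmx du) !mxE; apply: eq_bigr => k _.
by rewrite e.
Qed.

Definition rank_one (v : 'I_n -> F) (c : 'I_n) : 'M[F]_n :=
  \matrix_(i, j) (v i * (j == c)%:R).

Lemma mulmx_rank_one z v c i j :
  (z *m rank_one v c) i j = (\sum_l z i l * v l) * (j == c)%:R.
Proof. by rewrite mxE mulr_suml; apply: eq_bigr => l _; rewrite mxE mulrA. Qed.

Lemma rank_one_mulmx z v c i j : (rank_one v c *m z) i j = v i * z c j.
Proof.
rewrite mxE (bigD1 c) //= big1 ?addr0 ?mxE ?eqxx ?mulr1 // => l /negPf lc.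
by rewrite mxE lc mulr0 mul0r.
Qed.

(** The coefficients of column c at the left ends of s are removed by
    subtracting from it the columns of the corresponding right ends. Those at
    the right ends vanish because y squares to zero. *)
Lemma clear_column m s y (c : 'I_n) : c = m :> nat ->
    strict_square_zero y -> columns_normal m s y ->
  exists2 d, borel d & let y' := conj_mx (invmx d) y in
    columns_normal m s y' /\ forall i, s i != i -> y' i c = 0.
Proof.
move=> cm [yU yy] [sK sfix ycol].
pose v (l : 'I_n) : F := if (s l < l)%N then y (s l) c else 0.
pose V := rank_one v c.
have vc (l : 'I_n) : (c <= l)%N -> v l = 0.
  by move=> cl; rewrite /v sfix ?ltnn // -cm.
have VV : V *m V = 0.
  by apply/matrixP => i j; rewrite rank_one_mulmx !mxE (vc c) // mul0r mulr0.
pose d := 1%:M - V.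
have du : d \in unitmx.
  have : d *m (1%:M + V) = 1%:M.
    by rewrite mulmxDr mulmx1 mulmxBl mul1mx VV subr0 subrK.
  by case/mulmx1_unit.
have dB : borel d.
  apply/borelP; split=> // i j ji; rewrite !mxE (_ : (i == j) = false).
    case: eqVneq => [e|_]; last by rewrite mulr0 subr0.
    by rewrite vc ?mul0r ?subr0 // -e ltnW.
  by rewrite ord_eqE; lia.
have sqz := strict_square_zero_conj (borelV dB) (conj yU yy).
have subE (A B : 'M[F]_n) i j : (A - B) i j = A i j - B i j by rewrite !mxE.
have dmul z i j : (d *m z) i j = z i j - v i * z c j.
  by rewrite /d mulmxBl mul1mx subE rank_one_mulmx.
have muld z i j : (z *m d) i j = z i j - (\sum_l z i l * v l) * (j == c)%:R.
  by rewrite /d mulmxBr mulmx1 subE mulmx_rank_one.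
have yE (i j : 'I_n) : (j < c)%N -> conj_mx (invmx d) y i j = y i j.
  move=> jc; apply: conj_column => // {}i; rewrite dmul muld.
  rewrite (yU c j) ?addn1 1?ltnW // (_ : (j == c) = false) ?mulr0 //.
  by rewrite ord_eqE; lia.
pose z : 'M[F]_n := \matrix_(i, j) (y i c - \sum_l y i l * v l).
have yc i : conj_mx (invmx d) y i c = y i c - \sum_l y i l * v l.
  rewrite (@conj_column d y z c) // ?mxE // => {}i.
  rewrite dmul muld eqxx mulr1 (_ : z c c = 0) ?mulr0 ?subr0 mxE //.
  rewrite yU ?addn1 // add0r big1 ?oppr0 // => l _.
  have [cl|lc] := leqP c l; first by rewrite vc ?mulr0.
  by rewrite yU ?mul0r // addn1 ltnW.
exists d => //=; split.
  by split=> // i j jm; rewrite yE ?cm // ycol.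
have left_0 (i : 'I_n) : (i < s i)%N -> conj_mx (invmx d) y i c = 0.
  move=> isi; rewrite yc (bigD1 (s i)) //= big1 => [|l /negPf ls].
    have sic : (s i < m)%N.
      by rewrite ltnNge; apply/negP => /sfix; rewrite sK => e; rewrite -e ltnn in isi.
    by rewrite (ycol i (s i)) // mxE isi eqxx /v sK isi mul1r addr0 subrr.
  rewrite /v; case: ifP => sl; last by rewrite mulr0.
  have lm : (l < m)%N.
    by rewrite ltnNge; apply/negP => /sfix e; rewrite e ltnn in sl.
  by rewrite (ycol i l) // mxE eq_sym ls andbF mul0r.
move=> i si; have [isi|sii] := boolP (i < s i)%N; first exact: left_0.
have lt_si : (s i < i)%N by move: si sii; rewrite ord_eqE; lia.
have im : (i < m)%N.
  by rewrite ltnNge; apply/negP => /sfix e; rewrite e eqxx in si.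
have /matrixP/(_ (s i) c) := sqz.2; rewrite [LHS]mxE [RHS]mxE (bigD1 i) //= big1.
  by rewrite yE ?cm // (ycol _ i) // mxE sK lt_si eqxx mul1r addr0.
move=> k /negPf ki; have [kc|ck] := ltnP k c; last first.
  by rewrite (sqz.1 k c) ?mulr0 // addn1.
by rewrite yE // (ycol _ k) ?mxE -?cm // sK eq_sym ki andbF mul0r.
Qed.

(** Column c is now supported on fixed points of s. If it is nonzero, it becomes
    the basis vector of the last point a of its support, and s gains the arc
    (a, c). *)
Lemma extend_normal m s y (c : 'I_n) : c = m :> nat ->
    strict_square_zero y -> columns_normal m s y ->
    (forall i, s i != i -> y i c = 0) ->
  exists s' d, borel d /\ columns_normal m.+1 s' (conj_mx (invmx d) y).
Proof.
move=> cm [yU yy] [sK sfix ycol] y0.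
have sc : s c = c by rewrite sfix // cm.
have [z0|[i1]] := set_0Vmem [set i | y i c != 0].
  exists s, 1%:M; split; first exact: borel1.
  rewrite invmx1 conj_mx1; split=> // [j /ltnW|i j]; first exact: sfix.
  rewrite ltnS leq_eqVlt => /orP[/eqP jm|]; last exact: ycol.
  have -> : j = c by apply: val_inj; rewrite /= jm.
  have : i \notin [set i | y i c != 0] by rewrite z0 inE.
  rewrite inE negbK => /eqP->; rewrite mxE; case: andP => // -[ic /eqP e].
  by rewrite -[i]sK e sc ltnn in ic.
rewrite inE => yi1.
case: (@arg_maxnP _ i1 (fun i => y i c != 0) (fun i : 'I_n => i : nat) yi1) => a ya amax {i1 yi1}.
have sa : s a = a by apply/eqP; apply: contraNT ya => /y0->.
have ac : (a < c)%N by rewrite ltnNge; apply: contra ya => ca; rewrite yU // addn1.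
(* The matrix d replaces the basis vector of a by column c of y. *)
pose w i := y i c - (i == a)%:R; pose d := 1%:M + rank_one w a.
have dE i j : d i j = if j == a then y i c else (i == j)%:R.
  rewrite [d i j]mxE !mxE; case: (eqVneq j a) => [->|_]; last by rewrite mulr0 addr0.
  by rewrite mulr1 addrC subrK.
have dB : borel d.
  have dU : upper 0 d.
    move=> i j; rewrite addn0 dE => ji; case: eqP => [ja|_].
      apply/eqP; apply: contraTT ji => yi; rewrite ja -leqNgt; exact: amax.
    by rewrite (_ : (i == j) = false) // ord_eqE; lia.
  apply/borel_upper; split=> //.
  rewrite unitmxE -det_tr det_trig; last first.
    by apply/is_trig_mxP => i j ij; rewrite mxE dU ?addn0.
  rewrite unitfE prodf_seq_neq0; apply/allP => i _ /=; rewrite mxE dE.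
  by case: (eqVneq i a) => [->|_] //; rewrite eqxx oner_eq0.
have du : d \in unitmx by case/borelP: dB.
pose s' := (tperm a c * s)%g.
have ca : (c == a) = false by rewrite ord_eqE; lia.
have s'E i : s' i = if i == a then c else if i == c then a else s i.
  by rewrite permM; case: tpermP => [->|->|/eqP/negPf-> /eqP/negPf->]; rewrite ?eqxx ?ca.
have sE (i l : 'I_n) : s l = l -> (s i == l) = (i == l).
  by move=> sl; rewrite -{1}sl (inj_eq perm_inj).
have dmul z i j : (d *m z) i j = z i j + w i * z a j.
  by rewrite /d mulmxDl mul1mx mxE rank_one_mulmx.
have muld i j : (y *m d) i j = y i j - y i a * (j == a)%:R.
  rewrite /d mulmxDr mulmx1 mxE mulmx_rank_one -mulNr; congr (_ + _ * _).
  have /matrixP/(_ i c) := yy; rewrite !mxE => e.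
  rewrite /w; under eq_bigr do rewrite mulrBr; rewrite sumrB e sub0r.
  rewrite (bigD1 a) //= eqxx mulr1 big1 ?addr0 // => l /negPf->.
  by rewrite mulr0.
exists s', d; split=> //; split.
- move=> i; rewrite !s'E; have [->|ia] := eqVneq i a; first by rewrite ca eqxx.
  have [->|ic] := eqVneq i c; first by rewrite eqxx.
  by rewrite !sE // (negPf ia) (negPf ic) sK.
- move=> j mj; rewrite s'E (_ : (j == a) = false) 1?(_ : (j == c) = false) ?sfix //.
  + by apply: ltnW.
  + by rewrite ord_eqE; lia.
  by rewrite ord_eqE; lia.
move=> i j jm; rewrite (@conj_column d y (inv_mx F s') j) // => {}i.
rewrite dmul muld.
have -> : inv_mx F s' a j = (j == c)%:R.
  rewrite mxE s'E eqxx eq_sym; case: (eqVneq j c) => [->|_]; first by rewrite ac.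
  by rewrite andbF.
have [->|jc] := eqVneq j c.
  rewrite ca mulr0 subr0 mulr1 mxE s'E.
  have [->|ia] := eqVneq i a; first by rewrite ac eqxx /w eqxx addrC subrK.
  rewrite /w (negPf ia) subr0 (_ : _ && _ = false) ?add0r //.
  case: (eqVneq i c) => [->|ic]; first by rewrite ltnn.
  by rewrite sE // (negPf ic) andbF.
rewrite mulr0 addr0; have [->|ja] := eqVneq j a.
  rewrite mulr1 subrr mxE s'E.
  have [->|ia] := eqVneq i a; first by rewrite ltnn.
  case: (eqVneq i c) => [->|ic]; first by rewrite ltnNge ltnW.
  by rewrite sE // (negPf ia) andbF.
have jlt : (j < m)%N by move: jm jc; rewrite ord_eqE; lia.
rewrite mulr0 subr0 ycol // !mxE s'E.
have [->|ia] := eqVneq i a.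
  by rewrite sa eq_sym (negPf jc) [a == j]eq_sym (negPf ja) !andbF.
by have [->|//] := eqVneq i c; rewrite ltnNge -ltnS cm jm.
Qed.

Theorem normal_form x : strict_square_zero x ->
  exists s, involutive s /\ borel_orbit s x.
Proof.
move=> xs.
have H m : (m <= n)%N -> exists s b, borel b /\ columns_normal m s (conj_mx (invmx b) x).
  elim: m => [_|m IH lt_mn].
    exists 1%g, 1%:M; split; first exact: borel1.
    by split=> // [j|j _]; rewrite !perm1.
  have [s [b [bB nf]]] := IH (ltnW lt_mn).
  have xs' := strict_square_zero_conj (borelV bB) xs.
  have [d dB [nf' y0]] := @clear_column m s _ (Ordinal lt_mn) erefl xs' nf.
  have xs'' := strict_square_zero_conj (borelV dB) xs'.
  have [s' [d' [dB' nf'']]] := extend_normal (c := Ordinal lt_mn) erefl xs'' nf' y0.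
  have uB (e : 'M[F]_n) : borel e -> e \in unitmx by case/borelP.
  exists s', (b *m d *m d'); split; first exact: borelM (borelM bB dB) dB'.
  have bdu : b *m d \in unitmx by rewrite unitmx_mul !uB.
  have [[ub ud] ud'] := (uB _ bB, uB _ dB, uB _ dB').
  rewrite invmxM // invmxM // -conj_mxM ?unitmx_mul ?unitmx_inv ?ub ?ud //.
  by rewrite -conj_mxM ?unitmx_inv.
have [s [b [bB [sK _ nf]]]] := H n (leqnn n).
have bu : b \in unitmx by case/borelP: bB.
exists s; split=> //; exists b => //.
rewrite -/(conj_mx b _) (_ : inv_mx F s = conj_mx (invmx b) x) ?conj_invK //.
by apply/matrixP => i j; rewrite nf.
Qed.

End NormalForm.

(** * Intersections of closures *)

Section Assembly.
Local Open Scope classical_set_scope.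

Variables (F : numFieldType) (n : nat).
Implicit Types (x : 'M[F]_n) (s u : 'S_n).

Lemma inv_mx_square_zero s : involutive s -> inv_mx F s *m inv_mx F s = 0.
Proof.
move=> sK; apply/matrixP => i j; rewrite !mxE big1 // => l _; rewrite !mxE.
case: andP => [[il /eqP sil]|]; rewrite ?mul0r //.
case: andP => [[lj /eqP slj]|]; rewrite ?mulr0 //.
by move: il lj; rewrite -slj -sil sK; lia.
Qed.

Lemma inv_mx_class s : involutive s ->
  @square_zero_class F n (arcs s 0 n) (inv_mx F s).
Proof. by move=> sK; split; [exact: inv_mx_square_zero|exact: rank_inv_mx]. Qed.

Lemma orbit_class s x : involutive s -> @borel_orbit F n s x ->
  @square_zero_class F n (arcs s 0 n) x.
Proof.
move=> sK [b bB <-]; have bu : b \in unitmx by case/borelP: bB.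
have [NN Nr] := inv_mx_class sK.
split; last by rewrite -/(conj_mx b _) rank_conj.
by rewrite !mulmxA mulmxKV // -[b *m _ *m inv_mx F s]mulmxA NN mulmx0 mul0mx.
Qed.

Lemma closure_borel_inv s b x : borel b ->
  zariski_closure (@borel_orbit F n s) (conj_mx b x) ->
  zariski_closure (@borel_orbit F n s) x.
Proof.
move=> bB clx; have bu : b \in unitmx by case/borelP: bB.
have -> : x = invmx b *m (conj_mx b x) *m b.
  by rewrite /conj_mx !mulmxA mulVmx // mul1mx mulmxKV.
apply: closure_conj clx => _ [c cB <-]; apply: subset_zariski_closure.
have cu : c \in unitmx by case/borelP: cB.
exists (invmx b *m c); first exact: borelM (borelV bB) cB.
rewrite -/(conj_mx _ _) -conj_mxM ?unitmx_inv //.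
by rewrite {1}/conj_mx invmxK.
Qed.

(** A point x of the intersection is conjugate under the Borel group to some
    N_r. The rank conditions put r below s and t, hence below u by the
    hypothesis on the minimum. *)
Lemma closure_meet u s (t : 'S_n) : involutive u -> involutive s -> involutive t ->
    arcs_le u s -> arcs_le u t -> arcs u 0 n = arcs s 0 n -> arcs u 0 n = arcs t 0 n ->
    (forall i j, (minn (arcs s i j) (arcs t i j) <= arcs u i j)%N) ->
  zariski_closure (@borel_orbit F n s) `&` zariski_closure (@borel_orbit F n t)
    `&` @square_zero_class F n (arcs u 0 n) =
  zariski_closure (@borel_orbit F n u) `&` @square_zero_class F n (arcs u 0 n).
Proof.
move=> uK sK tK us ut es et umin; apply/seteqP; split=> x /=; last first.
  move=> [clx xO]; split=> //.
  by split; move: x clx {xO}; apply: zariski_closure_sub; apply: arcs_le_closure.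
move=> [[cls clt] xO]; split=> //.
have [xx xr] := xO.
have [r [rK [b bB xE]]] := normal_form (conj (closure_upper cls) xx).
rewrite -/(conj_mx b _) in xE.
have bu : b \in unitmx by case/borelP: bB.
have ru : arcs r 0 n = arcs u 0 n.
  by rewrite -xr -xE rank_conj // rank_inv_mx.
rewrite -xE in cls clt.
have rs := closure_arcs_le (closure_borel_inv bB cls).
have rt := closure_arcs_le (closure_borel_inv bB clt).
apply: (arcs_le_closure (u := r)) => //; last by exists b.
by move=> i j; apply: leq_trans (umin i j); rewrite leq_min rs rt.
Qed.

Lemma closure_irreducible s : involutive s ->
  zariski_irreducible (zariski_closure (@borel_orbit F n s) `&`
    @square_zero_class F n (arcs s 0 n)).
Proof.
move=> sK; split.
  exists (inv_mx F s); split; last exact: inv_mx_class.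
  by apply: subset_zariski_closure; apply: inv_mx_orbit.
move=> Y Z cY cZ XYZ.
have BX : @borel_orbit F n s `<=` zariski_closure (@borel_orbit F n s) `&`
    @square_zero_class F n (arcs s 0 n).
  by move=> x Bx; split; [exact: subset_zariski_closure|exact: orbit_class].
have [] := @irreducible_conj F n (inv_mx F s) (@borel F n) _ _ Y Z cY cZ.
- move=> g h t /borelP[gU _] /borelP[hU _] u; apply/borelP; split=> // i j ji.
  by rewrite !mxE gU // hU // subr0 mulr0 addr0.
- by move=> g /borelP[].
- exact: subset_trans BX XYZ.
- by move=> BY; left=> x [clx _]; apply: (closed_closure cY BY).
by move=> BZ; right=> x [clx _]; apply: (closed_closure cZ BZ).
Qed.

End Assembly.

From mathcomp Require Import complex.
From mathcomp Require Import reals.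

Local Close Scope ring_scope.

Lemma maximal_ancestor (F : numFieldType) (n k : nat) (u s s3 : 'S_n) :
    arcs u 0 n = k -> involutive s -> arcs s 0 n = k -> arcs_le u s -> s != u ->
    involutive s3 -> defects s3 = finset.set0 -> arcs s3 0 n = k ->
    (forall r : 'S_n, involutive r -> arcs u 0 n = arcs r 0 n -> arcs_le u r ->
       [\/ r = u, r = s | r = s3]) ->
  s \in ancestors F k u.
Proof.
move=> uk sK sk us nes s3K ds3 s3k above; rewrite inE; apply/and3P; split.
- exact/involutions_rankP.
- by rewrite /inv_lt eq_sym nes; apply/inv_leP.
apply/existsP => -[r /and3P[/involutionsP rK /andP[nr /inv_leP ur]]].
case/andP=> nr' /inv_leP rs.
have rk : arcs u 0 n = arcs r 0 n.
  by apply/eqP; rewrite eqn_leq ur uk -sk; apply: rs.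
case: (above r rK rk ur) => e; rewrite ?e ?eqxx // in nr nr'.
rewrite e in rs; have e3 : s = s3.
  by apply: no_defect_maximal => //; rewrite sk s3k.
by rewrite e3 eqxx in nr'.
Qed.

Lemma arcs_tableau (n k : nat) (T : tableau n k) : (2 * k <= n)%N ->
  arcs (tableau_perm T) 0 n = k.
Proof.
move=> kn; have [sK _ sR] := tableau_permP T kn.
rewrite arcs_right //.
have -> : [set j : 'I_n | (tableau_perm T j < j)%N]%SET = [set j in col2 T]%SET.
  by apply/setP => j; rewrite !inE sR.
have un : uniq (col2 T).
  have := enum_uniq 'I_n; rewrite -(perm_uniq (tableau_entries T)) cat_uniq.
  by case/and3P.
by rewrite cardsE (card_uniqP un) size_tuple.
Qed.

Local Open Scope classical_set_scope.

Theorem theorem4p1 (R : realType) (n k : nat) (T : tableau n k) (s' : 'S_n) :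
  (2 * k <= n)%N ->
  s' \in descendants (complex R) k (tableau_perm T) ->
  exists S : tableau n k,
    let O := @square_zero_class (complex R) n k in
    let closureB s := zariski_closure (@borel_orbit (complex R) n s) in
    let X := closureB (tableau_perm T) `&` closureB (tableau_perm S) `&` O in
    [/\ #|ancestors (complex R) k s'| = 2,
        ancestors (complex R) k s' = [set tableau_perm T; tableau_perm S]%SET,
        X = closureB s' `&` O
      & zariski_irreducible X].
Proof.
move=> kn; set F := complex R; set t := tableau_perm T.
rewrite inE => /and3P[/involutions_rankP[uK uk] /andP[neq /inv_leP us] nobetween].
have [tK dt _] := tableau_permP T kn; rewrite -/t in tK dt.
have tk : arcs t 0 n = k by exact: arcs_tableau.
have cover (r : 'S_n) : involutive r -> arcs_le s' r -> arcs_le r t -> r = s' \/ r = t.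
  move=> rK ur rt; have [->|ru] := eqVneq r s'; first by left.
  have [->|rt'] := eqVneq r t; first by right.
  case/existsP: nobetween; exists r; rewrite /inv_lt rt' [s' == _]eq_sym ru /=.
  by apply/and3P; split; [apply/involutionsP|apply/inv_leP|apply/inv_leP].
have eqk : arcs s' 0 n = arcs t 0 n by rewrite uk tk.
have [s2 [[s2K ds2 s2k s2t] us2 above umin]] :=
  descendant_of_no_defect uK tK us neq eqk dt cover.
have [S SE] : exists S : tableau n k, tableau_perm S = s2.
  by apply: exists_tableau => //; rewrite s2k.
have ancE : ancestors (complex R) k s' = [set t; s2]%SET.
  apply/setP => r; rewrite in_set2; apply/idP/orP => [|[/eqP->|/eqP->]].
  - rewrite inE => /and3P[/involutions_rankP[rK rk] /andP[nr /inv_leP ur] _].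
    have [e|->|->] := above r rK (etrans uk (esym rk)) ur; [|by left|by right].
    by rewrite e eqxx in nr.
  - by apply: (@maximal_ancestor _ _ _ s' t s2) => //; rewrite ?s2k // eq_sym.
  apply: (@maximal_ancestor _ _ _ s' s2 t) => //; rewrite ?s2k //.
    apply: contra_neq s2t => e; apply/esym/no_defect_maximal => //; rewrite ?e //.
  by move=> w wK wk uw; have [] := above w wK wk uw; [constructor 1|constructor 3|constructor 2].
exists S; rewrite /= SE.
have XE := closure_meet F uK tK s2K us us2 eqk (esym s2k) umin.
rewrite uk in XE; split=> //.
- by rewrite ancE cards2 eq_sym s2t.
rewrite [X in zariski_irreducible X]XE -uk; exact: closure_irreducible.
Qed.
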